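(* Let $1<p,q<\infty$ and let $X=L_{p,q}[0,1]$ be the Lorentz function space on $[0,1]$. Then: (1) $X$ has Boyd indices $p_X=q_X=p$. (2) $up(X)=\min\{p,q\}$ and $low(X)=\max\{p,q\}$. (3) $X$ has both the $UDS_q$-property and the $UDT_q$-property, and therefore $\ell_d(X)=u_d(X)=q$.
   Context: $L_{p,q}[0,1]$ is the space of all measurable real functions $f$ on $[0,1]$ (Lebesgue measure) with $\|f\|_{L_{p,q}}=\left(\int_0^1 (f^*(t))^q\,d(t^{q/p})\right)^{1/q}<\infty$, where $f^*$ is the decreasing rearrangement of $|f|$; it carries the pointwise a.e. order. (When $q>p$ this functional is a quasi-norm equivalent to a rearrangement invariant lattice norm, and the space is considered with such a norm; the notions below do not depend on this choice.) Boyd indices: for $0<s<\infty$ let $(D_sf)(t)=f(t/s)\chi_{[0,\min\{1,s\}]}(t)$, $0\le t\le1$. Then $p_X=\lim_{s\to\infty}\frac{\log s}{\log\|D_s\|}$ and $q_X=\lim_{s\to0^+}\frac{\log s}{\log\|D_s\|}$. A sequence $\{x_k\}_{k=1}^\infty$ in a Banach space has an upper $r$-estimate (resp. a lower $r$-estimate) with constant $C>0$ if for all $n\in\mathbb N$ and $a_1,\dots,a_n\in\mathbb R$, $\|\sum_{k=1}^n a_kx_k\|\le C(\sum_{k=1}^n|a_k|^r)^{1/r}$ (resp. $C(\sum_{k=1}^n|a_k|^r)^{1/r}\le\|\sum_{k=1}^n a_kx_k\|$). For $1<r<\infty$, a Banach lattice $X$ has the $UDS_r$-property (resp. $UDT_r$-property)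 if there is a constant $C>0$ such that every normalized disjoint sequence in $X$ has a subsequence with an upper $r$-estimate (resp. a lower $r$-estimate) with constant $C$. Put $\ell_d(X)=\sup\{r>1: X\text{ has the }UDS_r\text{-property}\}$ and $u_d(X)=\inf\{r>1: X\text{ has the }UDT_r\text{-property}\}$. For $1<r<\infty$, $X$ has a lattice upper $r$-estimate (resp. lattice lower $r$-estimate) if there is $C>0$ such that for every finite family of pairwise disjoint vectors $x_1,\dots,x_n\in X$, $\|\sum_{k=1}^n x_k\|\le C(\sum_{k=1}^n\|x_k\|^r)^{1/r}$ (resp. $(\sum_{k=1}^n\|x_k\|^r)^{1/r}\le C\|\sum_{k=1}^n x_k\|$). Put $up(X)=\sup\{r>1: X\text{ has a lattice upper }r\text{-estimate}\}$ and $low(X)=\inf\{r>1: X\text{ has a lattice lower }r\text{-estimate}\}$. *)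

(* Defs.v *)
From HB Require Import structures.
From mathcomp Require Import all_boot all_order all_algebra.
From mathcomp Require Import all_classical all_reals all_analysis.

Set Implicit Arguments.
Unset Strict Implicit.
Unset Printing Implicit Defensive.

Import Order.TTheory GRing.Theory Num.Theory.
Import numFieldNormedType.Exports.

Local Open Scope classical_set_scope.
Local Open Scope ring_scope.

(* A function on [0, 1] is represented by a function R -> R; every notion below
   only depends on its restriction to [0, 1], up to a null set.  Measurability
   is Borel measurability: every Lebesgue measurable function is almost
   everywhere equal to a Borel one, so the spaces of classes coincide. *)

Section PowerCumulative.
Context {R : realType}.

(* The maximum is needed because x `^ a = 1 for x < 0 <> a. *)
Definition pow_cumulative (a : {posnum R}) (t : R) : R :=
  Num.max t 0 `^ a%:num.

Let nd a : nondecreasing (pow_cumulative a).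
Proof.
move=> s t st; apply: ge0_ler_powR => //.
- by rewrite nnegrE le_max lexx orbT.
- by rewrite nnegrE le_max lexx orbT.
- by rewrite ge_max !le_max st lexx orbT.
Qed.

Let rc a : right_continuous (pow_cumulative a).
Proof.
move=> t; have [t0|t0|->] := ltgtP t 0.
- apply: (@cvg_trans _ (pow_cumulative a t @[_ --> t^'+])); last exact: cvg_cst.
  apply: near_eq_cvg; near=> u; rewrite /pow_cumulative.
  rewrite (max_r (ltW t0)) max_r//; near: u; exact: nbhs_right_le.
- apply: cvg_at_right_filter.
  have ct : {for t, continuous (fun u : R => u `^ a%:num)}.
    apply/differentiable_continuous/derivable1_diffP/derivable_powR.
    by rewrite in_itv/= t0.
  have -> : pow_cumulative a t = t `^ a%:num.
    by rewrite /pow_cumulative (max_l (ltW t0)).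
  apply: cvg_trans ct; apply: near_eq_cvg; near=> u.
  rewrite /pow_cumulative max_l//; apply: ltW; near: u; exact: lt_nbhsr.
- have -> : pow_cumulative a 0 = 0 by rewrite /pow_cumulative maxxx powR0.
  apply: (@cvg_trans _ (u `^ a%:num @[u --> 0^'+])); last exact: powR_cvg0.
  apply: near_eq_cvg; near=> u.
  by rewrite /pow_cumulative max_l.
Unshelve. all: by end_near. Qed.

HB.instance Definition _ (a : {posnum R}) :=
  isCumulative.Build R _ R (pow_cumulative a) (@nd a) (@rc a).

End PowerCumulative.

Section FunctionSpaces.
Context {R : realType}.
Implicit Types (f g : R -> R) (X : set (R -> R)) (N : (R -> R) -> R) (r : R).

Local Notation mu := (@lebesgue_measure R).
Local Notation I := (`[0%R, 1%R]%classic : set R).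

Definition distribution_fun f (y : R) : \bar R :=
  mu (I `&` [set t | y < `|f t|]).

Definition decr_rearr f (t : R) : \bar R :=
  ereal_inf [set y%:E | y in [set y | 0 <= y /\ (distribution_fun f y <= t%:E)%E]].

(* The integrator t^(q/p); as it is continuous, {0} is a null set. *)
Definition Lorentz_weight (p q : {posnum R}) :=
  lebesgue_stieltjes_measure (pow_cumulative (q%:num / p%:num)%:pos).

HB.instance Definition _ (p q : {posnum R}) := Measure.on (Lorentz_weight p q).

Definition Lorentz_functional (p q : {posnum R}) f : \bar R :=
  ((\int[Lorentz_weight p q]_(t in I) decr_rearr f t `^ q%:num)
     `^ (q%:num^-1)%R)%E.

Definition Lorentz (p q : {posnum R}) : set (R -> R) :=
  [set f | measurable_fun I f /\ (Lorentz_functional p q f < +oo)%E].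

Definition equimeasurable f g := distribution_fun f =1 distribution_fun g.

Record ri_lattice_norm X N : Prop := RILatticeNorm {
  ri_norm_ge0 : forall f, X f -> 0 <= N f ;
  ri_norm_eq0 : forall f, X f -> N f = 0 ->
    {ae mu, forall t, I t -> f t = 0} ;
  ri_normZ : forall a f, X f -> N (fun t => a * f t) = `|a| * N f ;
  ri_normD : forall f g, X f -> X g -> N (fun t => f t + g t) <= N f + N g ;
  ri_norm_le : forall f g, X f -> X g ->
    {ae mu, forall t, I t -> `|f t| <= `|g t|} -> N f <= N g ;
  ri_norm_equimeasurable : forall f g, X f -> X g ->
    equimeasurable f g -> N f = N g }.

Definition equivalent_on X N (N' : (R -> R) -> \bar R) :=
  exists c C : R, [/\ 0 < c, 0 < C & forall f, X f ->
    (c%:E * N' f <= (N f)%:E /\ (N f)%:E <= C%:E * N' f)%E].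

(* Completeness is not listed in ri_lattice_norm: it is inherited from the
   functional through the equivalence.
   For q <= p the functional is a norm; for q > p it is only a quasi-norm, and
   the space is considered with an arbitrary equivalent rearrangement invariant
   lattice norm. *)
Definition Lorentz_norm (p q : {posnum R}) N : Prop :=
  if q%:num <= p%:num then
    forall f, Lorentz p q f -> (N f)%:E = Lorentz_functional p q f
  else ri_lattice_norm (Lorentz p q) N /\
       equivalent_on (Lorentz p q) N (Lorentz_functional p q).

Definition dilation (s : R) f : R -> R :=
  fun t => f (t / s) * \1_(`[0, Num.min 1 s]%classic) t.

Definition opnorm X N (T : (R -> R) -> (R -> R)) : R :=
  sup [set N (T f) | f in [set f | X f /\ N f <= 1]].

(* s is eventually positive along both filters; the indices are asserted as
   limits, hence with existence of the limit. *)
Definition is_Boyd_p X N (b : R) :=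
  (ln s / ln (opnorm X N (dilation s))) @[s --> +oo] --> b.

Definition is_Boyd_q X N (b : R) :=
  (ln s / ln (opnorm X N (dilation s))) @[s --> 0^'+] --> b.

Definition disjoint_funs f g :=
  {ae mu, forall t, I t -> Num.min `|f t| `|g t| = 0}.

Definition normalized_disjoint X N (x : nat -> R -> R) :=
  [/\ forall k, X (x k), forall k, N (x k) = 1 &
      forall j k, j != k -> disjoint_funs (x j) (x k)].

Definition upper_estimate N r (C : R) (x : nat -> R -> R) :=
  forall (n : nat) (a : 'I_n -> R),
    N (fun t => \sum_(k < n) a k * x k t) <=
    C * (\sum_(k < n) `|a k| `^ r) `^ r^-1.

Definition lower_estimate N r (C : R) (x : nat -> R -> R) :=
  forall (n : nat) (a : 'I_n -> R),
    C * (\sum_(k < n) `|a k| `^ r) `^ r^-1 <=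
    N (fun t => \sum_(k < n) a k * x k t).

Definition UDS X N r :=
  exists2 C : R, 0 < C & forall x, normalized_disjoint X N x ->
    exists2 k : nat -> nat, {homo k : m n / (m < n)%N} &
      upper_estimate N r C (x \o k).

Definition UDT X N r :=
  exists2 C : R, 0 < C & forall x, normalized_disjoint X N x ->
    exists2 k : nat -> nat, {homo k : m n / (m < n)%N} &
      lower_estimate N r C (x \o k).

Definition lattice_upper_estimate X N r :=
  exists2 C : R, 0 < C & forall (n : nat) (x : 'I_n -> R -> R),
    (forall k, X (x k)) ->
    (forall j k, j != k -> disjoint_funs (x j) (x k)) ->
    N (fun t => \sum_(k < n) x k t) <=
    C * (\sum_(k < n) N (x k) `^ r) `^ r^-1.

Definition lattice_lower_estimate X N r :=
  exists2 C : R, 0 < C & forall (n : nat) (x : 'I_n -> R -> R),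
    (forall k, X (x k)) ->
    (forall j k, j != k -> disjoint_funs (x j) (x k)) ->
    (\sum_(k < n) N (x k) `^ r) `^ r^-1 <=
    C * N (fun t => \sum_(k < n) x k t).

(* Suprema and infima are taken in \bar R, so that those of the empty set and
   of unbounded sets are not junk values. *)

Definition ell_d X N : \bar R :=
  ereal_sup [set r%:E | r in [set r | 1 < r /\ UDS X N r]].

Definition u_d X N : \bar R :=
  ereal_inf [set r%:E | r in [set r | 1 < r /\ UDT X N r]].

Definition up_index X N : \bar R :=
  ereal_sup [set r%:E | r in [set r | 1 < r /\ lattice_upper_estimate X N r]].

Definition low_index X N : \bar R :=
  ereal_inf [set r%:E | r in [set r | 1 < r /\ lattice_lower_estimate X N r]].

End FunctionSpaces.

(* Main.v *)
From HB Require Import structures.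
Require Import Defs.
From mathcomp Require Import all_boot all_order all_algebra.
From mathcomp Require Import all_classical all_reals all_analysis.
From mathcomp Require Import measurable_realfun ring lra.

Set Implicit Arguments.
Unset Strict Implicit.
Unset Printing Implicit Defensive.

Import Order.TTheory GRing.Theory Num.Theory.
Import numFieldNormedType.Exports.

Local Open Scope classical_set_scope.
Local Open Scope ring_scope.

(* By Tonelli, ||f||^q is the integral over y > 0 of mu{|f|^q > y}^(q/p), and
   the distribution functions of disjoint functions add up.  The lattice
   estimates thus reduce to sub- or superadditivity of t^(q/p) (exponent q) and
   to Minkowski's inequality or its reverse for L_(q/p) (exponent p).
   For a normalized disjoint sequence x_k with distribution functions h_k, pass
   to a subsequence along which mu(supp x_(k+1)) is much smaller than the level
   a_k above which h_k carries almost all of its integral.  The parts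
   h_k 1_{h_k > a_k} then take values in rapidly decreasing disjoint intervals,
   and remain so after rescaling x_k, so that pointwise their sum is comparable
   to its maximum: the norm becomes an l_q norm. *)

(** * Inequalities for real powers *)

(** All the assertions survive a change of norm by bounded factors. The work is therefore done for
    the functional [F], even where it is only a quasi-norm; [N] enters through c F <= N <= C F and
    homogeneity. The obstacle is that the subsequence has to be chosen before the coefficients. This
    is why the distribution function of |f|^q is used: replacing f by a f dilates its argument by
    |a|^q and keeps its values, so truncation and separation by value do not see a, and the integral
    gains exactly the factor |a|^q. Sharpness in q: an upper r-estimate and a lower r'-estimate
    along a common subsequence force r <= r', by comparing n^(1/r') with n^(1/r). Thus UDS_q and
    UDT_q determine ell_d and u_d, and they also bound the lattice exponents by q, since lattice
    estimates imply UDS and UDT. Sharpness in p: the indicators of n intervals of length 1/n. Boyd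
    indices: D_s multiplies distribution functions by at most s, and small intervals show that this
    is optimal. The norm of D_s is s^(1/p) up to constants, which disappear in the quotient of
    logarithms. *)

Section PowerInequalities.
Context {R : realType}.
Implicit Types (a b c t u v x y : R).

Lemma convex_powR_real c t x y : 1 <= c -> 0 <= t <= 1 -> 0 <= x -> 0 <= y ->
  (t * x + (1 - t) * y) `^ c <= t * x `^ c + (1 - t) * y `^ c.
Proof.
move=> c1 /andP[t0 t1] x0 y0.
have := @convex_powR R c c1 (Itv01 t0 t1) x y.
by rewrite !inE/= !in_itv/= x0 y0 !convRE/=; apply.
Qed.

Lemma powR_weightM c t x : 0 < t -> 0 <= x ->
  t * (x / t) `^ c = t `^ (1 - c) * x `^ c.
Proof.
move=> t0 x0; rewrite powRM ?invr_ge0 ?(ltW t0)//.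
rewrite powRB ?powRr1 ?(ltW t0)//; last by rewrite (gt_eqF t0) implybT.
rewrite -[t^-1]powR_inv1 ?(ltW t0)// -powRrM mulN1r powRN.
by rewrite mulrA mulrAC.
Qed.

(** Concavity of z^c at the points u/t and v/(1-t) with weights t and 1-t, read off from convexity
    of z^(1/c) at the c-th powers of these points. *)
Lemma powRD_ge_weighted c t u v : 0 < c <= 1 -> 0 < t < 1 -> 0 <= u -> 0 <= v ->
  t `^ (1 - c) * u `^ c + (1 - t) `^ (1 - c) * v `^ c <= (u + v) `^ c.
Proof.
move=> /andP[c0 c1] /andP[t0 t1] u0 v0; have t'0 : 0 < 1 - t by rewrite subr_gt0.
rewrite -!powR_weightM//.
have c'1 : 1 <= c^-1 by rewrite invf_ge1.
have cK x : 0 <= x -> (x `^ c) `^ c^-1 = x.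
  by move=> x0; rewrite -powRrM mulfV ?gt_eqF// powRr1.
have := @convex_powR_real c^-1 t ((u / t) `^ c) ((v / (1 - t)) `^ c) c'1.
rewrite (ltW t0) (ltW t1) !powR_ge0 => /(_ isT isT isT).
rewrite !cK ?divr_ge0 ?(ltW t0) ?(ltW t'0)//.
rewrite !(mulrC _ (_ / _)) !divfK ?gt_eqF// => H.
have S0 : 0 <= (u / t) `^ c * t + (v / (1 - t)) `^ c * (1 - t).
  by rewrite addr_ge0// mulr_ge0 ?powR_ge0// ltW.
have := @ge0_ler_powR _ c (ltW c0) _ _ _ _ H; rewrite !nnegrE powR_ge0 addr_ge0//.
by move=> /(_ isT isT); rewrite -powRrM mulVf ?gt_eqF// powRr1 // ![t * _]mulrC ![(1 - t) * _]mulrC.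
Qed.

Lemma powRD_superadditive c u v : 1 <= c -> 0 <= u -> 0 <= v ->
  u `^ c + v `^ c <= (u + v) `^ c.
Proof.
move=> c1 u0 v0; have c0 : 0 < c by exact: lt_le_trans c1.
(* Here w^c = w w^(c-1), and w^(c-1) only grows when u or v is replaced by u + v. *)
rewrite -(mulr_powRB1 u0 c0) -(mulr_powRB1 v0 c0) -(mulr_powRB1 (addr_ge0 u0 v0) c0).
rewrite mulrDl lerD// ler_wpM2l// ge0_ler_powR ?nnegrE ?subr_ge0 ?addr_ge0//.
  by rewrite lerDl.
by rewrite lerDr.
Qed.

(** Superadditivity with exponent 1/c, applied to u^c and v^c. *)
Lemma powRD_subadditive c u v : 0 < c <= 1 -> 0 <= u -> 0 <= v ->
  (u + v) `^ c <= u `^ c + v `^ c.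
Proof.
move=> /andP[c0 c1] u0 v0.
have c'1 : 1 <= c^-1 by rewrite invf_ge1.
have := powRD_superadditive c'1 (powR_ge0 u c) (powR_ge0 v c).
rewrite -!powRrM mulfV ?gt_eqF// !powRr1// => H.
have := @ge0_ler_powR _ c (ltW c0) _ _ _ _ H; rewrite !nnegrE powR_ge0 addr_ge0//.
by move=> /(_ isT isT); rewrite -powRrM mulVf ?gt_eqF// powRr1// addr_ge0 ?powR_ge0.
Qed.

Lemma powR_sum_superadditive c n (u : 'I_n -> R) : 1 <= c ->
  (forall k, 0 <= u k) -> \sum_(k < n) u k `^ c <= (\sum_(k < n) u k) `^ c.
Proof.
move=> c1; have c0 : 0 < c by exact: lt_le_trans c1.
elim: n u => [|n IH] u u0; first by rewrite !big_ord0 powR_ge0.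
rewrite !big_ord_recr/=; apply: le_trans (powRD_superadditive c1 _ (u0 _)).
  by rewrite lerD2r; apply: IH.
by rewrite sumr_ge0.
Qed.

Lemma powR_sum_subadditive c n (u : 'I_n -> R) : 0 < c <= 1 ->
  (forall k, 0 <= u k) -> (\sum_(k < n) u k) `^ c <= \sum_(k < n) u k `^ c.
Proof.
move=> c01; have /andP[c0 c1] := c01.
elim: n u => [|n IH] u u0; first by rewrite !big_ord0 powR0 ?gt_eqF.
rewrite !big_ord_recr/=; apply: le_trans (powRD_subadditive c01 _ (u0 _)) _.
  by rewrite sumr_ge0.
by rewrite lerD2r; apply: IH.
Qed.

Lemma powRD_le2 c u v : 0 < c -> 0 <= u -> 0 <= v ->
  (u + v) `^ c <= 2 `^ c * (u `^ c + v `^ c).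
Proof.
move=> c0 u0 v0; wlog uv : u v u0 v0 / u <= v.
  move=> H; have [uv|/ltW vu] := leP u v; first exact: H.
  by rewrite addrC (addrC (u `^ c)); exact: H.
apply: (@le_trans _ _ ((2 * v) `^ c)).
  by rewrite ge0_ler_powR ?nnegrE ?(ltW c0)//; lra.
by rewrite powRM// ler_wpM2l ?powR_ge0// lerDr powR_ge0.
Qed.

(* A sum of numbers lying in rapidly decreasing intervals ]alpha_j, beta_j]
   (or equal to zero) is comparable to its first nonzero term. *)
Lemma sum_separated_le n (u al be : nat -> R) : (0 < n)%N ->
  (forall j, 0 <= u j) -> (forall j, 0 <= be j) -> (forall j, u j <= be j) ->
  (forall j, be j.+1 <= al j / 2) -> (forall j, al j <= be j) ->
  (forall j, u j = 0 \/ al j < u j) ->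
  exists2 k, (k < n)%N & \sum_(j < n) u j <= 2 * u k.
Proof.
move=> n0 u0 be0 ube beal albe ual.
(* Each upper end is at most half of the previous one, so a geometric series dominates the block. *)
have tail m k : \sum_(k <= j < k + m) u j <= 2 * be k.
  elim: m k => [|m IH] k; first by rewrite addn0 big_geq// mulr_ge0.
  rewrite big_ltn -addSnnS ?leq_addr//.
  have := IH k.+1; have := ube k; have := beal k; have := albe k; lra.
(* The witness is the first nonzero term u_k of the block, if there is one: the terms after it add
   up to at most 2 be_(k+1) <= al_k < u_k. *)
have main m k : exists2 i, (k <= i < k + m.+1)%N &
    \sum_(k <= j < k + m.+1) u j <= 2 * u i.
  elim: m k => [|m IH] k.
    exists k; first by rewrite leqnn addn1 ltnS/=.
    by rewrite addn1 big_nat1; have := u0 k; lra.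
  rewrite big_ltn -addSnnS ?leq_addr//; have [uk|uk] := ual k.
    rewrite uk add0r; have [i /andP[ki im] H] := IH k.+1.
    by exists i => //; rewrite (ltnW ki).
  exists k; first by rewrite leqnn leq_addr.
  have := tail m.+1 k.+1; have := beal k; lra.
case: n n0 => // n _.
rewrite -(big_mkord xpredT u).
have [i /andP[_ il] H] := main n 0%N.
by exists i; rewrite ?add0n// in il H *.
Qed.

End PowerInequalities.

(** * Minkowski inequalities for integrals of powers *)

Section PowerIntegral.
Context d (T : measurableType d) (R : realType).
Variable m : {measure set T -> \bar R}.
Implicit Types (c : R) (u v : T -> R).

Definition pow_int c u : \bar R := (\int[m]_y (u y `^ c)%:E)%E.

Lemma measurable_pow c u : measurable_fun setT u ->
  measurable_fun setT (fun y => (u y `^ c)%:E).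
Proof.
by move=> mu; apply/measurable_EFinP; exact: (measurableT_comp (measurable_powR c)).
Qed.

Lemma pow_int_ge0 c u : (0 <= pow_int c u)%E.
Proof. by apply: integral_ge0 => y _; rewrite lee_fin powR_ge0. Qed.

Lemma le_pow_int c u v : 0 < c -> measurable_fun setT u ->
  measurable_fun setT v -> (forall y, 0 <= u y <= v y) ->
  (pow_int c u <= pow_int c v)%E.
Proof.
move=> c0 mu mv uv; apply: ge0_le_integral => //; try exact: measurable_pow.
  by move=> y _; rewrite lee_fin powR_ge0.
move=> y _; rewrite lee_fin; have /andP[u0 uv'] := uv y.
by rewrite ge0_ler_powR ?nnegrE ?(ltW c0)// (le_trans u0).
Qed.

Lemma pow_int_minkowski c u v : 1 <= c -> measurable_fun setT u ->
  measurable_fun setT v -> (forall y, 0 <= u y) -> (forall y, 0 <= v y) ->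
  (pow_int c (fun y => u y + v y)%R `^ c^-1 <=
   pow_int c u `^ c^-1 + pow_int c v `^ c^-1)%E.
Proof.
move=> c1 mu mv u0 v0; have c0 : 0 < c by exact: lt_le_trans c1.
have LE w : (forall y, 0 <= w y) ->
    ('N[m]_c%:E[EFin \o w] = pow_int c w `^ c^-1)%E.
  move=> w0; rewrite unlock; congr (_ `^ _)%E; apply: eq_integral => y _ /=.
  by rewrite ger0_norm.
have := minkowski_EFin m mu mv c1.
by rewrite !LE// => y; rewrite addr_ge0.
Qed.

(** Let a and b be the L_c quasi-norms of u and v. The weighted inequality with t = a/(a+b)
    integrates to t^(1-c) a^c + (1-t)^(1-c) b^c, which is exactly (a+b)^c. Infinite and zero
    integrals are removed first, so that 0 < t < 1. *)
Lemma pow_int_reverse_minkowski c u v : 0 < c <= 1 -> measurable_fun setT u ->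
  measurable_fun setT v -> (forall y, 0 <= u y) -> (forall y, 0 <= v y) ->
  (pow_int c u `^ c^-1 + pow_int c v `^ c^-1 <=
   pow_int c (fun y => u y + v y)%R `^ c^-1)%E.
Proof.
move=> c01 mu mv u0 v0; have /andP[c0 c1] := c01.
have c'0 : 0 < c^-1 by rewrite invr_gt0.
have muv : measurable_fun setT (fun y => u y + v y) by exact: measurable_funD.
have Ju : (pow_int c u <= pow_int c (fun y => u y + v y)%R)%E.
  by apply: le_pow_int => // y; rewrite u0/= lerDl.
have Jv : (pow_int c v <= pow_int c (fun y => u y + v y)%R)%E.
  by apply: le_pow_int => // y; rewrite v0/= lerDr.
have [->|Jfin] := eqVneq (pow_int c (fun y => u y + v y)%R) +oo%E.
  by rewrite poweRyr ?gt_eqF// leey.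
have fin w : (pow_int c w <= pow_int c (fun y => u y + v y)%R)%E ->
    exists2 A, 0 <= A & pow_int c w = A%:E.
  move=> H; have w0 := pow_int_ge0 c w.
  have : pow_int c w \is a fin_num.
    by rewrite ge0_fin_numE// (le_lt_trans H)// ltey.
  by move=> /fineK wE; exists (fine (pow_int c w)); rewrite ?fine_ge0.
have mon w : (pow_int c w <= pow_int c (fun y => u y + v y)%R)%E ->
   (pow_int c w `^ c^-1 <= pow_int c (fun y => u y + v y)%R `^ c^-1)%E.
  by apply: gt0_ler_poweR; rewrite ?ltW ?in_itv/= ?pow_int_ge0 ?leey.
have [A A0 AE] := fin u Ju; have [B B0 BE] := fin v Jv.
have [A00|Ap] := eqVneq A 0.
  by rewrite AE A00 poweR0r ?gt_eqF// add0e mon.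
have [B00|Bp] := eqVneq B 0.
  by rewrite BE B00 poweR0r ?gt_eqF// adde0 mon.
have {}Ap : 0 < A by rewrite lt_def Ap.
have {}Bp : 0 < B by rewrite lt_def Bp.
have [S S0 SE] := fin _ (lexx _).
set a := A `^ c^-1; set b := B `^ c^-1.
have a0 : 0 < a by exact: powR_gt0.
have b0 : 0 < b by exact: powR_gt0.
have ac : a `^ c = A by rewrite -powRrM mulVf ?gt_eqF// powRr1.
have bc : b `^ c = B by rewrite -powRrM mulVf ?gt_eqF// powRr1.
have ab0 : 0 < a + b by exact: addr_gt0.
pose t := a / (a + b).
have t1 : 1 - t = b / (a + b) by rewrite /t; field; rewrite gt_eqF.
have t01 : 0 < t < 1.
  by rewrite divr_gt0//= -subr_gt0 t1 divr_gt0.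
have wE x : 0 < x -> (x / (a + b)) `^ (1 - c) * x `^ c = x / (a + b) `^ (1 - c).
  move=> x0; rewrite powRM ?invr_ge0 ?(ltW x0) ?(ltW ab0)// mulrAC.
  rewrite -powRD ?subrK ?powRr1 ?(ltW x0) ?(gt_eqF x0) ?implybT//.
  by rewrite -[_^-1]powR_inv1 ?(ltW ab0)// -powRrM mulN1r powRN.
have H : (a + b) `^ c <= S.
  rewrite -lee_fin -SE.
  have -> : ((a + b) `^ c)%:E =
      ((t `^ (1 - c))%:E * pow_int c u + ((1 - t) `^ (1 - c))%:E * pow_int c v)%E.
    rewrite AE BE -!EFinM -EFinD; congr EFin.
    transitivity ((a + b) `^ 1 / (a + b) `^ (1 - c)).
      by rewrite -powRB ?(gt_eqF ab0) ?implybT//; congr (_ `^ _); ring.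
    by rewrite powRr1 ?(ltW ab0)// t1 -ac -bc !wE// -mulrDl.
  rewrite /pow_int -!ge0_integralZl_EFin ?powR_ge0//; try exact: measurable_pow;
    try by move=> y _; rewrite lee_fin powR_ge0.
  rewrite -ge0_integralD//; first 1 last.
  - by move=> y _; rewrite -EFinM lee_fin mulr_ge0 ?powR_ge0.
  - by apply: emeasurable_funM => //; exact: measurable_pow.
  - by move=> y _; rewrite -EFinM lee_fin mulr_ge0 ?powR_ge0.
  - by apply: emeasurable_funM => //; exact: measurable_pow.
  apply: ge0_le_integral => //.
  - by move=> y _; rewrite -!EFinM -EFinD lee_fin addr_ge0// mulr_ge0 ?powR_ge0.
  - by apply: emeasurable_funD; apply: emeasurable_funM => //; exact: measurable_pow.
  - exact: measurable_pow.
  - by move=> y _; rewrite -!EFinM -EFinD lee_fin powRD_ge_weighted.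
rewrite AE BE SE !poweR_EFin -/a -/b -EFinD lee_fin.
have := @ge0_ler_powR _ c^-1 (ltW c'0) _ _ _ _ H.
by rewrite !nnegrE powR_ge0 S0 -powRrM mulfV ?gt_eqF// powRr1 ?(ltW ab0)//; apply.
Qed.

Lemma measurable_fun_sum_ord n (u : 'I_n -> T -> R) :
  (forall k, measurable_fun setT (u k)) ->
  measurable_fun setT (fun y => \sum_(k < n) u k y).
Proof. exact: measurable_sum. Qed.

Lemma pow_int0 c : 0 < c -> pow_int c (fun=> 0) = 0%E.
Proof.
by move=> c0; rewrite /pow_int powR0 ?gt_eqF// integral0.
Qed.

Lemma pow_int_sum_le c n (u : 'I_n -> T -> R) : 0 < c <= 1 ->
  (forall k, measurable_fun setT (u k)) -> (forall k y, 0 <= u k y) ->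
  (pow_int c (fun y => \sum_(k < n) u k y)%R <= \sum_(k < n) pow_int c (u k))%E.
Proof.
move=> c01 mu u0; rewrite -ge0_integral_sum//; first last.
- by move=> k y _; rewrite lee_fin powR_ge0.
- by move=> k; exact: measurable_pow.
apply: ge0_le_integral => //.
- by move=> y _; rewrite lee_fin powR_ge0.
- by apply: measurable_pow; exact: measurable_fun_sum_ord.
- by apply: emeasurable_sum => k; exact: measurable_pow.
- by move=> y _; rewrite sumEFin lee_fin powR_sum_subadditive.
Qed.

Lemma pow_int_sum_ge c n (u : 'I_n -> T -> R) : 1 <= c ->
  (forall k, measurable_fun setT (u k)) -> (forall k y, 0 <= u k y) ->
  (\sum_(k < n) pow_int c (u k) <= pow_int c (fun y => \sum_(k < n) u k y)%R)%E.
Proof.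
move=> c1 mu u0; rewrite -ge0_integral_sum//; first last.
- by move=> k y _; rewrite lee_fin powR_ge0.
- by move=> k; exact: measurable_pow.
apply: ge0_le_integral => //.
- by move=> y _; apply: sume_ge0 => k _; rewrite lee_fin powR_ge0.
- by apply: emeasurable_sum => k; exact: measurable_pow.
- by apply: measurable_pow; exact: measurable_fun_sum_ord.
- by move=> y _; rewrite sumEFin lee_fin powR_sum_superadditive.
Qed.

Lemma pow_int_minkowski_sum c n (u : 'I_n -> T -> R) : 1 <= c ->
  (forall k, measurable_fun setT (u k)) -> (forall k y, 0 <= u k y) ->
  (pow_int c (fun y => \sum_(k < n) u k y)%R `^ c^-1 <=
   \sum_(k < n) pow_int c (u k) `^ c^-1)%E.
Proof.
move=> c1; have c0 : 0 < c by exact: lt_le_trans c1.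
elim: n u => [|n IH] u mu u0.
  rewrite big_ord0; under [X in pow_int c X]eq_fun do rewrite big_ord0.
  by rewrite pow_int0// poweR0r// gt_eqF// invr_gt0.
rewrite big_ord_recr/=; under [X in pow_int c X]eq_fun do rewrite big_ord_recr/=.
apply: le_trans (pow_int_minkowski c1 _ (mu _) _ (u0 _)) _.
- by apply: measurable_fun_sum_ord => k; exact: mu.
- by move=> y; rewrite sumr_ge0.
- by apply: leeD => //; apply: IH.
Qed.

Lemma pow_int_reverse_minkowski_sum c n (u : 'I_n -> T -> R) : 0 < c <= 1 ->
  (forall k, measurable_fun setT (u k)) -> (forall k y, 0 <= u k y) ->
  (\sum_(k < n) pow_int c (u k) `^ c^-1 <=
   pow_int c (fun y => \sum_(k < n) u k y)%R `^ c^-1)%E.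
Proof.
move=> c01; have /andP[c0 c1] := c01.
elim: n u => [|n IH] u mu u0; first by rewrite big_ord0 poweR_ge0.
rewrite big_ord_recr/=; under [X in (_ <= pow_int c X `^ _)%E]eq_fun do rewrite big_ord_recr/=.
apply: le_trans (pow_int_reverse_minkowski c01 _ (mu _) _ (u0 _)).
- by apply: leeD => //; apply: IH.
- by apply: measurable_fun_sum_ord => k; exact: mu.
- by move=> y; rewrite sumr_ge0.
Qed.

End PowerIntegral.

(** * Truncations and separated sums *)

Section Truncation.
Context d (T : measurableType d) (R : realType).
Variable m : {measure set T -> \bar R}.
Implicit Types (a c : R) (u : T -> R).

(** The cut is by value and not by argument, so that it commutes with dilations of the argument. *)
Definition low_part a u : T -> R := fun y => if u y <= a then u y else 0.
Definition high_part a u : T -> R := fun y => if u y <= a then 0 else u y.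

Lemma measurable_low_part a u :
  measurable_fun setT u -> measurable_fun setT (low_part a u).
Proof.
by move=> mu; apply: measurable_fun_ifT => //; exact: measurable_fun_ler.
Qed.

Lemma measurable_high_part a u :
  measurable_fun setT u -> measurable_fun setT (high_part a u).
Proof.
by move=> mu; apply: measurable_fun_ifT => //; exact: measurable_fun_ler.
Qed.

Lemma low_part_ge0 a u y : (forall y, 0 <= u y) -> 0 <= low_part a u y.
Proof. by move=> u0; rewrite /low_part; case: ifP. Qed.

Lemma high_part_ge0 a u y : (forall y, 0 <= u y) -> 0 <= high_part a u y.
Proof. by move=> u0; rewrite /high_part; case: ifP. Qed.

Lemma low_high_part a u y : u y = low_part a u y + high_part a u y.
Proof. by rewrite /low_part /high_part; case: ifP; rewrite ?addr0 ?add0r. Qed.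

Lemma pow_int_low_high a c u : 0 < c -> measurable_fun setT u ->
  pow_int m c u = (pow_int m c (low_part a u) + pow_int m c (high_part a u))%E.
Proof.
move=> c0 mu; rewrite /pow_int -ge0_integralD//.
- apply: eq_integral => y _; rewrite /low_part /high_part -EFinD.
  by case: ifP; rewrite powR0 ?gt_eqF// ?addr0 ?add0r.
- by move=> y _; rewrite lee_fin powR_ge0.
- by apply: measurable_pow; exact: measurable_low_part.
- by move=> y _; rewrite lee_fin powR_ge0.
- by apply: measurable_pow; exact: measurable_high_part.
Qed.

(** Dominated convergence: the parts below 1/(n+1) tend to 0 pointwise and stay below [u]. *)
Lemma pow_int_low_part_small c u e : 0 < c -> measurable_fun setT u ->
  (forall y, 0 <= u y) -> (pow_int m c u < +oo)%E -> 0 < e ->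
  exists2 a, 0 < a & (pow_int m c (low_part a u) <= e%:E)%E.
Proof.
move=> c0 mu u0 Ju e0.
have H : (pow_int m c (low_part n.+1%:R^-1 u) @[n --> \oo] --> 0%E)%E.
  have [|||||_ _] := @dominated_convergence _ _ _ m setT measurableT
    (fun n y => (low_part n.+1%:R^-1 u y `^ c)%:E) (fun=> 0%E)
    (fun y => (u y `^ c)%:E); last by rewrite integral0.
  - by move=> n; apply: measurable_pow; exact: measurable_low_part.
  - exact: measurable_cst.
  - apply: aeW => y _; apply: (@cvg_trans _ (0 @[n --> \oo])%E); last exact: cvg_cst.
    have [uy0|uyp] := eqVneq (u y) 0.
      by apply: near_eq_cvg; near=> n; rewrite /low_part uy0 if_same powR0 ?gt_eqF.
    have {}uyp : 0 < u y by rewrite lt_def uyp u0.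
    apply: near_eq_cvg; near=> n; rewrite /low_part ifF ?powR0 ?gt_eqF//.
    apply/negbTE; rewrite -ltNge.
    by near: n; exact: (near_infty_natSinv_lt (PosNum uyp)).
  - apply/integrableP; split; first exact: measurable_pow.
    under eq_integral do rewrite gee0_abs ?lee_fin ?powR_ge0//.
    exact: Ju.
  - apply: aeW => y n _; rewrite gee0_abs ?lee_fin ?powR_ge0//.
    rewrite ge0_ler_powR ?nnegrE ?(ltW c0) ?low_part_ge0//.
    by rewrite /low_part; case: ifP.
have [n nn] : exists n, (pow_int m c (low_part n.+1%:R^-1 u) <= e%:E)%E.
  have : \forall n \near \oo, (pow_int m c (low_part n.+1%:R^-1 u) < e%:E)%E.
    by apply: (H [set x | x < e%:E]%E); apply: open_ereal_lt'; rewrite lte_fin.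
  by case=> n _ /(_ n (leqnn n)) /ltW nn; exists n.
by exists n.+1%:R^-1 => //; rewrite invr_gt0.
Unshelve. all: by end_near. Qed.

(** Pointwise, the c-th powers of the high parts add up to at most twice one of them, hence to at
    most twice the c-th power of the whole sum. Separation is asked of the c-th powers, because
    these are summed and [c] may be less than 1. *)
Lemma pow_int_separated_ge c (g : nat -> T -> R) (al be S : nat -> R) M n :
  0 < c -> (forall j, measurable_fun setT (g j)) -> (forall j y, 0 <= g j y) ->
  (forall j y, g j y <= be j) -> (forall j, 0 <= al j) ->
  (forall j, al j <= be j) -> (forall j, be j.+1 `^ c <= al j `^ c / 2) ->
  (forall j, ((M * S j)%:E <= pow_int m c (high_part (al j) (g j)))%E) ->
  ((M / 2 * \sum_(j < n) S j)%:E <=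
   pow_int m c (fun y => \sum_(j < n) g j y)%R)%E.
Proof.
move=> c0 mg g0 gbe al0 albe beal HS.
have [->|n0] := posnP n; first by rewrite big_ord0 mulr0 pow_int_ge0.
have mhigh j := measurable_high_part (al j) (mg j).
have mG := measurable_fun_sum_ord (fun j : 'I_n => mg j).
have high0 j y : 0 <= high_part (al j) (g j) y by exact: high_part_ge0.
have be0 j : 0 <= be j by exact: le_trans (albe j).
have pw y : \sum_(j < n) high_part (al j) (g j) y `^ c <=
            2 * (\sum_(j < n) g j y) `^ c.
  have [||||||k kn H] := @sum_separated_le _ n
    (fun j => high_part (al j) (g j) y `^ c) (fun j => al j `^ c)
    (fun j => be j `^ c) n0.
  - by move=> j; exact: powR_ge0.
  - by move=> j; exact: powR_ge0.
  - move=> j; rewrite ge0_ler_powR ?nnegrE ?(ltW c0)//.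
    by rewrite /high_part; case: ifP.
  - exact: beal.
  - by move=> j; rewrite ge0_ler_powR ?nnegrE ?(ltW c0).
  - move=> j; rewrite /high_part; case: ifPn => [_|].
      by left; rewrite powR0 ?gt_eqF.
    rewrite -ltNge => lt; right.
    by rewrite gt0_ltr_powR ?nnegrE ?al0 ?g0.
  apply: le_trans H _; rewrite ler_wpM2l//.
  rewrite ge0_ler_powR ?nnegrE ?(ltW c0) ?high0 ?sumr_ge0//.
  rewrite (bigD1 (Ordinal kn))//= (le_trans (y := g k y))//.
    by rewrite /high_part; case: ifP.
  by rewrite lerDl sumr_ge0.
have : ((M * \sum_(j < n) S j)%:E <=
    2%:E * pow_int m c (fun y => \sum_(j < n) g j y)%R)%E.
  rewrite mulr_sumr -sumEFin.
  apply: (@le_trans _ _ (\sum_(j < n) pow_int m c (high_part (al j) (g j)))%E).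
    by apply: lee_sum => j _; exact: HS.
  rewrite /pow_int -ge0_integral_sum//; first last.
  - by move=> j y _; rewrite lee_fin powR_ge0.
  - by move=> j; exact: measurable_pow.
  rewrite -ge0_integralZl_EFin//; first last.
  - exact: measurable_pow.
  - by move=> y _; rewrite lee_fin powR_ge0.
  apply: ge0_le_integral => //.
  - by move=> y _; apply: sume_ge0 => k _; rewrite lee_fin powR_ge0.
  - by apply: emeasurable_sum => k; exact: measurable_pow.
  - by apply: emeasurable_funM => //; exact: measurable_pow.
  - by move=> y _; rewrite sumEFin -EFinM lee_fin pw.
have := pow_int_ge0 m c (fun y => \sum_(j < n) g j y).
case: (pow_int m c _) => [r _|_ _|]; last 2 first.
- by rewrite leey.
- by rewrite leeNy_eq.
by rewrite -EFinM !lee_fin; lra.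
Qed.

Lemma sum_half_powers n : \sum_(j < n) (2 ^- j.+1 : R) <= 1.
Proof.
suff -> : \sum_(j < n) (2 ^- j.+1 : R) = 1 - 2 ^- n.
  by rewrite gerBl invr_ge0 exprn_ge0.
elim: n => [|n IH]; first by rewrite big_ord0 expr0 invr1 subrr.
by rewrite big_ord_recr/= IH exprS invfM; lra.
Qed.

(** The weight 2^(j+1) limits the j-th term to the share 2^-(j+1) of W^(1/c), where W is the
    right-hand side, and the shares add up to at most 1. *)
Lemma powR_sum_geometric c n (u : nat -> R) : 0 < c -> (forall j, 0 <= u j) ->
  (\sum_(j < n) u j) `^ c <= \sum_(j < n) (2 ^+ j.+1) `^ c * u j `^ c.
Proof.
move=> c0 u0; pose w j := 2 ^+ j.+1 * u j.
have w0 j : 0 <= w j by rewrite mulr_ge0 ?exprn_ge0.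
have -> : \sum_(j < n) (2 ^+ j.+1) `^ c * u j `^ c = \sum_(j < n) w j `^ c.
  by apply: eq_bigr => j _; rewrite powRM ?exprn_ge0.
set W := \sum_(j < n) _; have W0 : 0 <= W.
  by apply: sumr_ge0 => j _; exact: powR_ge0.
have wW (j : 'I_n) : w j <= W `^ c^-1.
  have -> : w j = (w j `^ c) `^ c^-1.
    by rewrite -powRrM mulfV ?gt_eqF// powRr1.
  rewrite ge0_ler_powR ?nnegrE ?invr_ge0 ?(ltW c0) ?powR_ge0//.
  by rewrite /W (bigD1 j)//= lerDl sumr_ge0// => i _; exact: powR_ge0.
have : \sum_(j < n) u j <= W `^ c^-1.
  apply: (@le_trans _ _ (\sum_(j < n) 2 ^- j.+1 * W `^ c^-1)).
    apply: ler_sum => j _; rewrite mulrC ler_pdivlMr ?exprn_gt0// mulrC.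
    exact: wW.
  by rewrite -mulr_suml ler_piMl ?powR_ge0// sum_half_powers.
move=> H; have := @ge0_ler_powR _ c (ltW c0) _ _ _ _ H.
rewrite !nnegrE powR_ge0 sumr_ge0// -powRrM mulVf ?gt_eqF// powRr1//.
exact.
Qed.

(** The high parts add up pointwise to at most twice one of them. The low parts are not separated;
    they are summed with geometric weights, whose growth is cancelled by the prescribed smallness of
    their integrals. *)
Lemma pow_int_separated_le c (g : nat -> T -> R) (al be S : nat -> R) M n :
  1 <= c -> (forall j, measurable_fun setT (g j)) -> (forall j y, 0 <= g j y) ->
  (forall j y, g j y <= be j) -> (forall j, 0 <= al j) ->
  (forall j, al j <= be j) -> (forall j, be j.+1 <= al j / 2) ->
  (forall j, (pow_int m c (low_part (al j) (g j)) <=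
              ((2 ^+ j.+1) `^ (- c) * S j)%:E)%E) ->
  (forall j, (pow_int m c (g j) <= (M * S j)%:E)%E) ->
  (pow_int m c (fun y => \sum_(j < n) g j y)%R <=
   (2 `^ c * (2 `^ c * M + 1) * \sum_(j < n) S j)%:E)%E.
Proof.
move=> c1 mg g0 gbe al0 albe beal HS HM.
have c0 : 0 < c by exact: lt_le_trans c1.
have [->|n0] := posnP n.
  rewrite big_ord0 mulr0; under [X in pow_int m c X]eq_fun do rewrite big_ord0.
  by rewrite pow_int0.
have mlow j := measurable_low_part (al j) (mg j).
have mG := measurable_fun_sum_ord (fun j : 'I_n => mg j).
have high0 j y : 0 <= high_part (al j) (g j) y by exact: high_part_ge0.
have low0 j y : 0 <= low_part (al j) (g j) y by exact: low_part_ge0.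
have be0 j : 0 <= be j by exact: le_trans (albe j).
(* One factor 2^c comes from splitting the sum into high and low parts. The second factor of [A]
   comes from doubling the dominating high part, that of [B] is the geometric weight. *)
pose A : R := 2 `^ c * 2 `^ c.
pose B j : R := 2 `^ c * (2 ^+ j.+1) `^ c.
have A0 : 0 <= A by rewrite mulr_ge0 ?powR_ge0.
have B0 j : 0 <= B j by rewrite mulr_ge0 ?powR_ge0.
have pw y : (\sum_(j < n) g j y) `^ c <=
    \sum_(j < n) (A * g j y `^ c + B j * low_part (al j) (g j) y `^ c).
  have -> : \sum_(j < n) g j y = \sum_(j < n) high_part (al j) (g j) y +
                                 \sum_(j < n) low_part (al j) (g j) y.
    by rewrite -big_split/=; apply: eq_bigr => j _; rewrite addrC -low_high_part.
  apply: le_trans (powRD_le2 c0 _ _) _; try by apply: sumr_ge0.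
  rewrite mulrDr big_split/= lerD//; last first.
    rewrite (_ : \sum_(j < n) B j * _ = 2 `^ c *
      \sum_(j < n) (2 ^+ j.+1) `^ c * low_part (al j) (g j) y `^ c); last first.
      by rewrite mulr_sumr; apply: eq_bigr => j _; rewrite mulrA.
    rewrite ler_wpM2l ?powR_ge0//.
    exact: (@powR_sum_geometric c n (fun j => low_part (al j) (g j) y)).
  rewrite (_ : \sum_(j < n) A * _ = 2 `^ c *
    \sum_(j < n) 2 `^ c * g j y `^ c); last first.
    by rewrite mulr_sumr; apply: eq_bigr => j _; rewrite mulrA.
  rewrite ler_wpM2l ?powR_ge0//.
  have [||||||k kn H] := @sum_separated_le _ n
    (fun j => high_part (al j) (g j) y) al be n0.
  - by move=> j; exact: high0.
  - exact: be0.
  - by move=> j; rewrite /high_part; case: ifP.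
  - exact: beal.
  - exact: albe.
  - move=> j; rewrite /high_part; case: ifPn => [_|]; first by left.
    by rewrite -ltNge; right.
  rewrite -mulr_sumr; apply: (@le_trans _ _ (2 `^ c * g k y `^ c)).
    rewrite -powRM// ge0_ler_powR ?nnegrE ?(ltW c0)//.
    - exact: sumr_ge0.
    - exact: mulr_ge0.
    - apply: le_trans H _; rewrite ler_wpM2l//.
      by rewrite /high_part; case: ifP.
  rewrite ler_wpM2l ?powR_ge0// (bigD1 (Ordinal kn))//= lerDl.
  by rewrite sumr_ge0// => j _; exact: powR_ge0.
apply: (@le_trans _ _ (\sum_(j < n) (A%:E * pow_int m c (g j) +
    (B j)%:E * pow_int m c (low_part (al j) (g j))))%E).
  pose F (j : 'I_n) y :=
    (A%:E * (g j y `^ c)%:E + (B j)%:E * (low_part (al j) (g j) y `^ c)%:E)%E.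
  have mF j : measurable_fun setT (F j).
    by apply: emeasurable_funD; apply: emeasurable_funM => //; exact: measurable_pow.
  have F0 j y : (0 <= F j y)%E.
    by rewrite /F -!EFinM -EFinD lee_fin addr_ge0// mulr_ge0 ?powR_ge0.
  have FE (j : 'I_n) : (A%:E * pow_int m c (g j) +
      (B j)%:E * pow_int m c (low_part (al j) (g j)) = \int[m]_y F j y)%E.
    rewrite /pow_int -!ge0_integralZl_EFin//; try exact: measurable_pow;
      try by move=> y _; rewrite lee_fin powR_ge0.
    rewrite -ge0_integralD//.
    - by move=> y _; rewrite -EFinM lee_fin mulr_ge0 ?powR_ge0.
    - by apply: emeasurable_funM => //; exact: measurable_pow.
    - by move=> y _; rewrite -EFinM lee_fin mulr_ge0 ?powR_ge0.
    - by apply: emeasurable_funM => //; exact: measurable_pow.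
  under eq_bigr do rewrite FE.
  rewrite -ge0_integral_sum//; apply: ge0_le_integral => //.
  - by move=> y _; rewrite lee_fin powR_ge0.
  - exact: measurable_pow.
  - exact: emeasurable_sum.
  - by move=> y _; apply: le_trans (_ : (_ <= (_ : R)%:E)%E) _;
      [rewrite lee_fin; exact: pw|rewrite -sumEFin].
rewrite mulr_sumr -sumEFin; apply: lee_sum => j _.
apply: (@le_trans _ _ (A%:E * (M * S j)%:E +
    (B j)%:E * ((2 ^+ j.+1) `^ (- c) * S j)%:E)%E).
  by apply: leeD; rewrite lee_wpmul2l ?lee_fin.
rewrite -!EFinM -EFinD lee_fin /A /B powRN.
rewrite [X in _ + X](_ : _ = 2 `^ c * S j); last first.
  by field; rewrite gt_eqF// powR_gt0// exprn_gt0.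
by rewrite le_eqVlt; apply/orP; left; apply/eqP; ring.
Qed.

End Truncation.

(** * Distribution functions *)

Section Scaling.
Context {R : realType}.
Local Notation mu := (@lebesgue_measure R).

(** Uniqueness of Lebesgue measure: 1/c times the pushforward under y/c gives every interval its
    length. *)
Lemma lebesgue_measure_scale (c : R) (A : set R) : 0 < c -> measurable A ->
  mu ((fun y => y / c) @^-1` A) = (c%:E * mu A)%E.
Proof.
move=> c0 mA.
have c'0 : 0 <= c^-1 by rewrite invr_ge0 ltW.
have mphi : measurable_fun [set: measurableTypeR R]
    ((fun y => y / c) : measurableTypeR R -> measurableTypeR R).
  exact: measurable_funM.
pose pm : {measure set (measurableTypeR R) -> \bar R} :=
  measure_function_pushforward__canonical__measure_function_Measure mu mphi.
pose nu : {measure set (measurableTypeR R) -> \bar R} := mscale (NngNum c'0) pm.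
have -> : mu A = nu A.
  apply: (@lebesgue_measure_unique R nu) => // _ [[a b]] _ <-.
  rewrite /nu /pm /= /mscale/= /pushforward.
  rewrite (_ : _ @^-1` _ = `]a * c, b * c]%classic); last first.
    by apply/seteqP; split => y /=; rewrite !in_itv/= ltr_pdivlMr// ler_pdivrMr.
  rewrite !lebesgue_measure_itv/= !lte_fin ltr_pM2r//; case: ifP => _.
    by rewrite -!EFinB -EFinM -mulrBl mulrCA mulVf ?gt_eqF// mulr1.
  by rewrite mule0.
by rewrite /mscale/= muleA -EFinM mulfV ?gt_eqF// mul1e.
Qed.

Lemma ge0_integral_scale (c : R) (f : R -> \bar R) : 0 < c ->
  measurable_fun setT f -> (forall y, 0 <= f y)%E ->
  (\int[mu]_y f (y / c)%R = c%:E * \int[mu]_y f y)%E.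
Proof.
move=> c0 mf f0.
have mphi : measurable_fun [set: measurableTypeR R]
    ((fun y => y / c) : measurableTypeR R -> measurableTypeR R).
  exact: measurable_funM.
transitivity (\int[mscale (NngNum (ltW c0)) mu]_y f y)%E; last first.
  by rewrite ge0_integral_mscale.
transitivity (\int[pushforward mu (fun y => y / c : measurableTypeR R)%R]_y f y)%E.
  by rewrite (ge0_integral_pushforward mphi).
by apply: eq_measure_integral => A mA _; exact: lebesgue_measure_scale.
Qed.

Lemma pow_int_scale c (r : R) (u : R -> R) : 0 < r -> measurable_fun setT u ->
  pow_int mu c (fun y => u (y / r)) = (r%:E * pow_int mu c u)%E.
Proof.
move=> r0 mu_; rewrite /pow_int.
rewrite -(@ge0_integral_scale r (fun y => (u y `^ c)%:E))//.
- exact: measurable_pow.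
- by move=> y; rewrite lee_fin powR_ge0.
Qed.

End Scaling.

Section Distribution.
Context {R : realType}.
Implicit Types (f g : R -> R) (y z : R).
Local Notation mu := (@lebesgue_measure R).
Local Notation I := (`[0%R, 1%R]%classic : set R).

Lemma measurable_superlevel f y : measurable_fun I f ->
  measurable (I `&` [set t | y < `|f t|]).
Proof.
move=> mf.
have : measurable_fun I (fun t => `|f t|) by exact: measurableT_comp.
move=> /(_ (measurable_itv _) `]y, +oo[%classic (measurable_itv _)).
by congr measurable; apply/seteqP; split => t [It yt]; split => //;
  move: yt; rewrite /= in_itv/= andbT.
Qed.

Lemma distribution_fun_ge0 f y : (0 <= distribution_fun f y)%E.
Proof. exact: measure_ge0. Qed.

Lemma lebesgue_measure_unit_itv : mu I = 1%E.
Proof. by rewrite lebesgue_measure_itv/= lte_fin ltr01 oppr0 adde0. Qed.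

Lemma distribution_fun_le1 f y : measurable_fun I f ->
  (distribution_fun f y <= 1)%E.
Proof.
move=> mf; rewrite -lebesgue_measure_unit_itv le_measure ?inE//.
exact: measurable_superlevel.
Qed.

Lemma distribution_fun_fin_num f y : measurable_fun I f ->
  distribution_fun f y \is a fin_num.
Proof.
move=> mf; rewrite ge0_fin_numE ?distribution_fun_ge0//.
by rewrite (le_lt_trans (distribution_fun_le1 y mf))// ltry.
Qed.

Lemma distribution_fun_nonincreasing f y z : measurable_fun I f -> y <= z ->
  (distribution_fun f z <= distribution_fun f y)%E.
Proof.
move=> mf yz; rewrite le_measure ?inE//; try exact: measurable_superlevel.
by move=> t [It /= zt]; split => //=; exact: le_lt_trans zt.
Qed.

Variable q : R.
Hypothesis q0 : 0 < q.

(* The distribution function of |f|^q, extended by zero to the negative axis. *)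
Definition tail f y : R :=
  if 0 <= y then fine (distribution_fun f (y `^ q^-1)) else 0.

Lemma tail_ge0 f y : 0 <= tail f y.
Proof. by rewrite /tail; case: ifP => // _; rewrite fine_ge0// distribution_fun_ge0. Qed.

Lemma tail_le1 f y : measurable_fun I f -> tail f y <= 1.
Proof.
move=> mf; rewrite /tail; case: ifP => // _.
by rewrite -lee_fin fineK ?distribution_fun_fin_num// distribution_fun_le1.
Qed.

Lemma EFin_tail f y : measurable_fun I f -> 0 <= y ->
  (tail f y)%:E = distribution_fun f (y `^ q^-1).
Proof. by move=> mf y0; rewrite /tail y0 fineK// distribution_fun_fin_num. Qed.

Lemma tail_le f y z : measurable_fun I f -> 0 <= y <= z -> tail f z <= tail f y.
Proof.
move=> mf /andP[y0 yz]; have z0 : 0 <= z by exact: le_trans yz.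
rewrite -lee_fin !EFin_tail// distribution_fun_nonincreasing//.
by rewrite ge0_ler_powR ?nnegrE ?invr_ge0 ?(ltW q0).
Qed.

(** [tail f 0] is the measure of the set where [f] does not vanish; this is how the size of supports
    enters. *)
Lemma tail_le0 f y : measurable_fun I f -> tail f y <= tail f 0.
Proof.
move=> mf; have [y0|y0] := leP 0 y; first by rewrite tail_le// lexx.
by rewrite {1}/tail [0 <= y]leNgt y0/= tail_ge0.
Qed.

Lemma measurable_tail f : measurable_fun I f -> measurable_fun setT (tail f).
Proof.
(* The extension by zero breaks monotonicity at 0; cutting the argument off at 0 restores it. *)
move=> mf; rewrite (_ : tail f = fun y => if 0 <= y then tail f (Num.max y 0) else 0).
  apply: measurable_fun_ifT => //; first exact: measurable_fun_ler.
  apply: nonincreasing_measurable => // y z yz.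
  by rewrite tail_le// le_max lexx orbT/= ge_max !le_max yz lexx orbT.
apply/funext => y; case: (leP 0 y) => [//|y0].
by rewrite /tail [0 <= y]leNgt y0.
Qed.

(* Disjointness only holds almost everywhere, so the superlevel sets are
   compared through the integrals of their indicators. *)
Lemma distribution_funD f g y : measurable_fun I f -> measurable_fun I g ->
  disjoint_funs f g -> 0 <= y ->
  distribution_fun (fun t => f t + g t) y =
  (distribution_fun f y + distribution_fun g y)%E.
Proof.
move=> mf mg fg y0.
have mfg : measurable_fun I (fun t => f t + g t) by exact: measurable_funD.
have mI : measurable I by exact: measurable_itv.
have dE (h : R -> R) : measurable_fun I h ->
    distribution_fun h y = (\int[mu]_(t in I) (\1_(I `&` [set t | y < `|h t|]%R) t)%:E)%E.
  move=> mh; rewrite integral_indic//; last exact: measurable_superlevel.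
  by rewrite setIAC setIid.
have mind (h : R -> R) : measurable_fun I h ->
    measurable_fun I (fun t => (\1_(I `&` [set t | y < `|h t|]%R) t)%:E : \bar R).
  move=> mh; apply/measurable_EFinP/measurable_funTS/measurable_indic.
  exact: measurable_superlevel.
rewrite !dE// -ge0_integralD//; try exact: mind; try by move=> t _; rewrite lee_fin.
apply: ge0_ae_eq_integral => //; try by move=> t _; rewrite ?adde_ge0// lee_fin.
- exact: mind.
- by apply: emeasurable_funD; exact: mind.
move: fg; apply: filterS; first exact: (ae_filter_ringOfSetsType mu).
move=> t /= fgt It; have {}fgt := fgt It.
have iE (h : R -> R) : \1_(I `&` [set t | y < `|h t|]%R) t = (y < `|h t|)%R%:R :> R.
  rewrite indicE; congr (nat_of_bool _)%:R; apply/idP/idP.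
    by rewrite inE => -[].
  by move=> yh; rewrite inE; split.
rewrite -EFinD !iE; congr EFin.
have [fg0|fg0] : f t = 0 \/ g t = 0.
- by move: fgt; case: (leP `|f t| `|g t|) => _ /normr0_eq0; [left|right].
- by rewrite fg0 add0r normr0 [y < 0]ltNge y0 add0r.
- by rewrite fg0 addr0 normr0 [y < 0]ltNge y0 addr0.
Qed.

Lemma tailD f g : measurable_fun I f -> measurable_fun I g ->
  disjoint_funs f g ->
  tail (fun t => f t + g t) = fun y => tail f y + tail g y.
Proof.
move=> mf mg fg; apply/funext => y; rewrite /tail; case: ifP => y0; last by rewrite addr0.
by rewrite distribution_funD ?powR_ge0// fineD ?distribution_fun_fin_num.
Qed.

Lemma distribution_fun_zero y : 0 <= y -> distribution_fun (fun=> 0 : R) y = 0%E.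
Proof.
move=> y0; rewrite /distribution_fun [X in mu X](_ : _ = set0) ?measure0//.
by apply/seteqP; split => t //= [_]; rewrite normr0 ltNge y0.
Qed.

Lemma tail_zero : tail (fun=> 0) = fun=> 0.
Proof.
by apply/funext => y; rewrite /tail distribution_fun_zero ?powR_ge0// if_same.
Qed.

Lemma disjoint_funs_sum n (x : 'I_n -> R -> R) g :
  (forall k, disjoint_funs (x k) g) ->
  disjoint_funs (fun t => \sum_(k < n) x k t) g.
Proof.
elim: n x => [|n IH] x xg.
  by apply: aeW => t _; rewrite big_ord0 normr0 min_l.
have H := IH _ (fun k => xg (widen_ord (leqnSn n) k)).
move: H (xg ord_max); apply: filterS2; first exact: (ae_filter_ringOfSetsType mu).
move=> t H1 H2 It; have {}H1 := H1 It; have {}H2 := H2 It.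
rewrite big_ord_recr/=; have [g0|g0] := eqVneq `|g t| 0.
  by rewrite g0 min_r.
have z (u : R) : Num.min `|u| `|g t| = 0 -> u = 0.
  by case: (leP `|u| `|g t|) => [_ /normr0_eq0//|_ /eqP]; rewrite (negbTE g0).
by rewrite (z _ H1) (z _ H2) addr0 normr0 min_l.
Qed.

Lemma tail_sum n (x : 'I_n -> R -> R) :
  (forall k, measurable_fun I (x k)) ->
  (forall j k, j != k -> disjoint_funs (x j) (x k)) ->
  tail (fun t => \sum_(k < n) x k t) = fun y => \sum_(k < n) tail (x k) y.
Proof.
elim: n x => [|n IH] x mx dx.
  under eq_fun do rewrite big_ord0; rewrite tail_zero.
  by apply/funext => y; rewrite big_ord0.
under eq_fun do rewrite big_ord_recr/=.
rewrite (@tailD (fun t => \sum_(k < n) x (widen_ord (leqnSn n) k) t)).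
- rewrite IH; first by apply/funext => y; rewrite big_ord_recr.
  + by move=> k; exact: mx.
  + by move=> j k jk; apply: dx; apply: contra_neq jk => /(congr1 val)/= /val_inj.
- by apply: measurable_sum => k; exact: mx.
- exact: mx.
- apply: disjoint_funs_sum => k; apply: dx.
  by apply/eqP => /(congr1 val)/= kn; have := ltn_ord k; rewrite kn ltnn.
Qed.

(** Values are kept and only the argument is dilated. Using |f|^q makes the dilation factor |a|^q,
    which is what the q-th power of a norm should gain. *)
Lemma tailZ a f y : measurable_fun I f -> a != 0 ->
  tail (fun t => a * f t) y = tail f (y / `|a| `^ q).
Proof.
move=> mf a0; have an0 : 0 < `|a| by rewrite normr_gt0.
rewrite /tail ler_pdivlMr ?powR_gt0// mul0r; case: ifP => // y0.
congr fine; rewrite /distribution_fun powRM ?invr_ge0 ?powR_ge0//.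
rewrite -[(`|a| `^ q)^-1]powRN -powRrM mulNr mulfV ?gt_eqF// powR_inv1 ?(ltW an0)//.
congr (mu (_ `&` _)); apply/seteqP; split => t /=.
  by rewrite normrM ltr_pdivrMr// mulrC.
by rewrite ltr_pdivrMr// normrM mulrC.
Qed.

End Distribution.

(** * The Lorentz functional as an integral over levels *)

Section LayerCake.
Context {R : realType}.
Implicit Types (f g : R -> R) (p q : {posnum R}) (t y h : R).
Local Notation mu := (@lebesgue_measure R).
Local Notation I := (`[0%R, 1%R]%classic : set R).

Lemma Lorentz_weight_itvoc p q a b : a <= b ->
  Lorentz_weight p q `]a, b]%classic =
  (pow_cumulative (q%:num / p%:num)%:pos b -
   pow_cumulative (q%:num / p%:num)%:pos a)%:E.
Proof.
move=> ab; rewrite /Lorentz_weight /lebesgue_stieltjes_measure.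
rewrite /measure_extension measurable_mu_extE/=; last exact: is_ocitv.
by rewrite wlength_itv_bnd.
Qed.

(** The interval is squeezed between ]-1, h] and the intervals ]0, y^(1/c)] with y < h^c. The weight
    vanishes on the negative axis and has no atom at 0. *)
Lemma Lorentz_weight_itvco p q h : 0 <= h ->
  Lorentz_weight p q `[0, h[%classic = (h `^ (q%:num / p%:num))%:E.
Proof.
move=> h0; set c := (q%:num / p%:num); have c0 : 0 < c by rewrite /c.
set W := Lorentz_weight p q _.
have cumE y : 0 <= y -> pow_cumulative (q%:num / p%:num)%:pos y = y `^ c.
  by move=> y0; rewrite /pow_cumulative max_l.
have cum0 y : y <= 0 -> pow_cumulative (q%:num / p%:num)%:pos y = 0.
  by move=> y0; rewrite /pow_cumulative max_r// powR0// gt_eqF.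
have Wle : (W <= (h `^ c)%:E)%E.
  apply: (@le_trans _ _ (Lorentz_weight p q `](-1), h]%classic)).
    by rewrite le_measure ?inE//; apply: subset_itv; rewrite bnd_simp.
  by rewrite Lorentz_weight_itvoc ?(le_trans _ h0)// cumE// cum0// subr0.
have Wge y : 0 <= y -> y < h `^ c -> (y%:E <= W)%E.
  move=> y0 yh; have yE : (y `^ c^-1) `^ c = y.
    by rewrite -powRrM mulVf ?gt_eqF// powRr1.
  have lt : y `^ c^-1 < h.
    by rewrite ltNge; apply/negP => H; move: yh; rewrite ltNge -{1}yE;
       rewrite ge0_ler_powR ?nnegrE ?powR_ge0 ?(ltW c0).
  have -> : y%:E = Lorentz_weight p q `]0, y `^ c^-1]%classic.
    by rewrite Lorentz_weight_itvoc ?powR_ge0// cumE ?powR_ge0// cum0// yE subr0.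
  rewrite le_measure ?inE// => u /=; rewrite !in_itv/= => /andP[/ltW -> uy]/=.
  exact: le_lt_trans lt.
apply/eqP; rewrite eq_le Wle/=.
have W0 : (0 <= W)%E by exact: measure_ge0.
move: Wle W0 Wge; case: W => [w|//|//]; rewrite !lee_fin => wh w0 Wge.
rewrite leNgt; apply/negP => lt.
have := Wge ((w + h `^ c) / 2); rewrite lee_fin; lra.
Qed.

(** With [decr_rearr_ge] this is a Galois connection up to the case of equality, which below affects
    only one endpoint of an interval. *)
Lemma decr_rearr_lt f t y : 0 <= y -> (y%:E < decr_rearr f t)%E ->
  (t%:E < distribution_fun f y)%E.
Proof.
move=> y0; rewrite !ltNge; apply: contra => H.
by apply: ereal_inf_lbound; exists y.
Qed.

Lemma decr_rearr_ge f t y : measurable_fun I f ->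
  (t%:E < distribution_fun f y)%E -> (y%:E <= decr_rearr f t)%E.
Proof.
move=> mf H; apply: le_ereal_inf_tmp => _ [z [z0 Hz] <-].
rewrite lee_fin leNgt; apply/negP => zy.
have := le_lt_trans Hz H; rewrite ltNge => /negP; apply.
by apply: distribution_fun_nonincreasing => //; exact: ltW.
Qed.

Lemma decr_rearr_ge0 f t : (0 <= decr_rearr f t)%E.
Proof. by apply: le_ereal_inf_tmp => _ [z [z0 _] <-]; rewrite lee_fin. Qed.

Lemma lebesgue_measure_itv0y : mu `[0, +oo[%classic = +oo%E.
Proof. by rewrite lebesgue_measure_itv/= ltry. Qed.

(** With r = f*(t), the superlevel set lies between [0, r^q[ and [0, r^q], which have the same
    measure. If r is infinite, as happens at t = 0 for essentially unbounded f, it is the whole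
    half-line. *)
Lemma measure_tail_superlevel q f t : measurable_fun I f -> 0 <= t ->
  mu [set y | t < tail q%:num f y] = (decr_rearr f t `^ q%:num)%E.
Proof.
move=> mf t0; set S := [set y | _].
have mtail : measurable_fun setT (tail q%:num f) by exact: measurable_tail.
have mS : measurable S.
  have := mtail measurableT `]t, +oo[%classic (measurable_itv _).
  by congr measurable; apply/seteqP; split => y /=; rewrite in_itv/= andbT//; case.
have S0 y : S y -> 0 <= y.
  by rewrite /S/= /tail; case: ifP => // _; rewrite ltNge t0.
have SE y : 0 <= y -> S y <-> (t%:E < distribution_fun f (y `^ q%:num^-1))%E.
  by move=> y0; rewrite -EFin_tail// lte_fin.
have qK y : 0 <= y -> (y `^ q%:num^-1) `^ q%:num = y.
  by move=> y0; rewrite -powRrM mulVf// powRr1.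
have Kq y : 0 <= y -> (y `^ q%:num) `^ q%:num^-1 = y.
  by move=> y0; rewrite -powRrM mulfV// powRr1.
have := @decr_rearr_ge f t _ mf; have := @decr_rearr_lt f t.
have := decr_rearr_ge0 f t; case: (decr_rearr f t) => [r| |//].
  rewrite lee_fin => r0 Hlt Hge; rewrite poweR_EFin.
  have rq0 : 0 <= r `^ q%:num by exact: powR_ge0.
  have lt_itv (b : bool) : mu [set` Interval (BLeft 0) (BSide b (r `^ q%:num))] =
      (r `^ q%:num)%:E.
    rewrite lebesgue_measure_itv/=; case: ifPn; first by rewrite oppr0 adde0.
    rewrite lte_fin -leNgt => H; congr EFin; apply/eqP; rewrite eq_le rq0.
    by rewrite H.
  apply/eqP; rewrite eq_le; apply/andP; split.
    rewrite -(lt_itv false) le_measure ?inE// => y Sy /=.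
    have y0 := S0 _ Sy; rewrite in_itv/= y0/=.
    have := Hge _ ((SE _ y0).1 Sy); rewrite lee_fin => H.
    by rewrite -[leLHS]qK// ge0_ler_powR ?nnegrE ?powR_ge0.
  rewrite -(lt_itv true) le_measure ?inE// => y /=.
  rewrite in_itv/= => /andP[y0 yr]; apply/(SE _ y0)/Hlt; first exact: powR_ge0.
  by rewrite lte_fin -[ltRHS]Kq// gt0_ltr_powR ?nnegrE ?invr_gt0.
move=> _ Hlt _; rewrite poweRyr ?gt_eqF//.
rewrite (_ : S = `[0, +oo[%classic) ?lebesgue_measure_itv0y//.
apply/seteqP; split => y /=; rewrite in_itv/= andbT; first exact: S0.
by move=> y0; apply/(SE _ y0)/Hlt; rewrite ?powR_ge0 ?ltry.
Qed.

(* Tonelli's theorem for the region {(t, y) | 0 <= t < tail f y}. *)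
Lemma Lorentz_functionalE p q f : measurable_fun I f ->
  Lorentz_functional p q f =
  (pow_int mu (q%:num / p%:num) (tail q%:num f) `^ q%:num^-1)%E.
Proof.
move=> mf; rewrite /Lorentz_functional; congr (_ `^ _)%E.
have mtail : measurable_fun setT (tail q%:num f) by exact: measurable_tail.
pose E := [set z : measurableTypeR R * measurableTypeR R |
  (0 <= z.1 :> R) && (z.1 < tail q%:num f z.2 :> R)].
have mE : measurable E.
  have m1 : measurable_fun setT
      (fun z : measurableTypeR R * measurableTypeR R => (0 <= z.1 :> R)).
    by apply: measurable_fun_ler => //; exact: measurable_fst.
  have m2 : measurable_fun setT
      (fun z : measurableTypeR R * measurableTypeR R => (z.1 < tail q%:num f z.2 :> R)).
    apply: measurable_fun_ltr; first exact: measurable_fst.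
    exact: (measurableT_comp mtail measurable_snd).
  have := measurable_and m1 m2; move=> /(_ measurableT [set true] Logic.I).
  by rewrite setTI.
have mfE : measurable_fun [set: measurableTypeR R * measurableTypeR R]
    (fun z => (\1_E z)%:E : \bar R).
  exact/measurable_EFinP/measurable_indic.
have sliceE (m : {measure set (measurableTypeR R) -> \bar R}) (G : R -> R * R) (A : set R) :
    measurable A -> (forall x, E (G x) <-> A x) ->
    (\int[m]_x (\1_E (G x))%:E = m A)%E.
  move=> mA EA; have <- : (\int[m]_(x in setT) (\1_A x)%:E)%E = m A.
    by rewrite integral_indic// setIT.
  apply: eq_integral => x _; rewrite !indicE; congr (nat_of_bool _)%:R%:E.
  by apply/idP/idP; rewrite !inE; [move/EA|move=> ?; exact/EA].
transitivity (\int[Lorentz_weight p q]_t \int[mu]_y (\1_E (t, y))%:E)%E.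
  rewrite integral_mkcond; apply: eq_integral => t _; rewrite patchE.
  have mS : measurable [set y | t < tail q%:num f y].
    have := mtail measurableT `]t, +oo[%classic (measurable_itv _).
    by congr measurable; apply/seteqP; split => y /=; rewrite in_itv/= andbT//; case.
  case: ifPn; rewrite ?inE ?notin_setE/= in_itv/=.
    move=> /andP[t0 t1]; rewrite -measure_tail_superlevel//.
    by rewrite (sliceE mu (fun y => (t, y)) _ mS)// => y; rewrite /E/= t0.
  (* Outside [0, 1] the slices are empty, for t > 1 because [tail] is at most 1. The integral over
     [I] is thus one over the whole line. *)
  move=> tI; rewrite (sliceE mu (fun y => (t, y)) set0) ?measure0// => y.
  rewrite /E/=; split => // /andP[t0 ty]; apply: tI; rewrite t0/=.
  by apply: ltW; apply: lt_le_trans ty (tail_le1 _ _ mf).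
rewrite (fubini_tonelli (m1 := lebesgue_stieltjes_measure
   (pow_cumulative (q%:num / p%:num)%:pos)) (m2 := mu) (fun z => (\1_E z)%:E))//.
apply: eq_integral => y _.
rewrite -Lorentz_weight_itvco ?tail_ge0//.
apply: (sliceE (Lorentz_weight p q) (fun t => (t, y))) => // t.

Qed.

End LayerCake.

(** * Lattice estimates for the functional *)

Section LorentzSpace.
Context {R : realType}.
Variables p q : {posnum R}.
Implicit Types (f g : R -> R).
Local Notation mu := (@lebesgue_measure R).
Local Notation I := (`[0%R, 1%R]%classic : set R).
Local Notation gam := (q%:num / p%:num).
Local Notation X := (Lorentz p q).
Local Notation tl := (tail q%:num).

Definition Lorentz_fun f : R := fine (Lorentz_functional p q f).
Local Notation F := Lorentz_fun.

Let gam_gt0 : 0 < gam. Proof. by []. Qed.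

Lemma Lorentz_fun_ge0 f : 0 <= F f.
Proof. by rewrite fine_ge0// poweR_ge0. Qed.

Lemma EFin_Lorentz_fun f : X f -> (F f)%:E = Lorentz_functional p q f.
Proof. by move=> [_ Ff]; rewrite fineK// ge0_fin_numE// poweR_ge0. Qed.

Lemma LorentzP f : measurable_fun I f ->
  X f <-> (pow_int mu gam (tl f) < +oo)%E.
Proof.
move=> mf; split=> [[_]|H]; [|split=> //]; rewrite Lorentz_functionalE//.
  by apply: lty_poweRy; rewrite invr_neq0.
exact: poweR_lty.
Qed.

Lemma pow_int_tail f : X f -> pow_int mu gam (tl f) = (F f `^ q%:num)%:E.
Proof.
move=> Xf; have [mf _] := Xf; have /(LorentzP mf) fin := Xf.
rewrite /F Lorentz_functionalE// fine_poweR -powRrM mulVf// powRr1.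
  by rewrite fineK// ge0_fin_numE// pow_int_ge0.
by rewrite fine_ge0// pow_int_ge0.
Qed.

Lemma Lorentz_pow_int f (r : R) : measurable_fun I f ->
  pow_int mu gam (tl f) = r%:E -> X f /\ F f = r `^ q%:num^-1.
Proof.
move=> mf rE; split; first by apply/LorentzP; rewrite // rE ltry.
by rewrite /F Lorentz_functionalE// rE.
Qed.

Lemma tailZ0 f a : measurable_fun I f ->
  tl (fun t => a * f t) = if a == 0 then fun=> 0 else
    fun y => tl f (y / `|a| `^ q%:num).
Proof.
move=> mf; have [->|a0] := eqVneq a 0.
  by under eq_fun do rewrite mul0r; rewrite tail_zero.
by apply/funext => y; rewrite tailZ.
Qed.

Lemma LorentzZ a f : X f -> X (fun t => a * f t) /\ F (fun t => a * f t) = `|a| * F f.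
Proof.
move=> Xf; have [mf _] := Xf.
have maf : measurable_fun I (fun t => a * f t) by exact: measurable_funM.
have [|XZ FZ] := @Lorentz_pow_int (fun t => a * f t) (`|a| `^ q%:num * F f `^ q%:num) maf.
  rewrite tailZ0//; case: eqVneq => [->|a0].
    by rewrite pow_int0// normr0 powR0// mul0r.
  rewrite pow_int_scale ?powR_gt0 ?normr_gt0//; last exact: measurable_tail.
  by rewrite pow_int_tail.
split=> //; rewrite FZ -powRM ?Lorentz_fun_ge0// -powRrM mulfV// powRr1//.
by rewrite mulr_ge0 ?Lorentz_fun_ge0.
Qed.

Lemma pow_int_scale_val c (u : R -> R) : 0 <= c -> measurable_fun setT u ->
  (forall y, 0 <= u y) ->
  pow_int mu gam (fun y => c * u y) = ((c `^ gam)%:E * pow_int mu gam u)%E.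
Proof.
move=> c0 mu_ u0; rewrite /pow_int -ge0_integralZl_EFin ?powR_ge0//.
- by apply: eq_integral => y _; rewrite powRM.
- by move=> y _; rewrite lee_fin powR_ge0.
- exact: measurable_pow.
Qed.

(** * Dilations and indicator functions *)

Lemma measurable_dilation s f : 0 < s -> measurable_fun I f ->
  measurable_fun I (dilation s f).
Proof.
move=> s0 mf; apply: measurable_funTS.
(* [f] is measurable on [I] only. On [0, min 1 s] the argument t/s stays in [I], so [f] may be
   replaced by its extension by zero. *)
rewrite (_ : dilation s f =
    fun t => (f \_ I) (t / s) * \1_(`[0, Num.min 1 s]%classic) t).
  apply: measurable_funM; last exact: measurable_indic.
  apply: (measurableT_comp (f := f \_ I)); last exact: measurable_funM.
  by apply/(measurable_restrictT _ _).1.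
apply/funext => t; rewrite /dilation indicE.
case: (boolP (t \in _)) => [|_]; last by rewrite !mulr0.
rewrite inE/= in_itv/= le_min => /and3P[t0 _ ts]; congr (_ * _).
by rewrite patchE ifT// inE/= in_itv/= divr_ge0 ?(ltW s0)//= ler_pdivrMr// mul1r.
Qed.

(** The superlevel set of the dilated function lies in s times that of [f]; for s > 1 the part
    beyond 1 is cut off, whence only an inequality. *)
Lemma tail_dilation s f y : 0 < s -> measurable_fun I f ->
  tl (dilation s f) y <= s * tl f y.
Proof.
move=> s0 mf; have [y0|y0] := leP 0 y; last first.
  by rewrite /tail [0 <= y]leNgt y0/= mulr0.
rewrite -lee_fin EFinM !EFin_tail//; last exact: measurable_dilation.
rewrite -lebesgue_measure_scale//; last exact: measurable_superlevel.
rewrite le_measure ?inE//.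
- by apply: measurable_superlevel; exact: measurable_dilation.
- have mphi : measurable_fun setT (fun t : R => t / s) by exact: measurable_funM.
  rewrite -[X in measurable X]setTI; apply: mphi => //.
  exact: measurable_superlevel.
- move=> t [_ /=]; rewrite /dilation indicE.
  case: (boolP (t \in _)) => [|_]; last first.
    by rewrite mulr0 normr0 ltNge powR_ge0.
  rewrite inE/= in_itv/= le_min mulr1 => /and3P[t0 _ ts] yt; split=> //=.
  by rewrite in_itv/= divr_ge0 ?(ltW s0)//= ler_pdivrMr// mul1r.
Qed.

Lemma Lorentz_dilation s f : 0 < s -> X f ->
  X (dilation s f) /\ F (dilation s f) <= s `^ p%:num^-1 * F f.
Proof.
move=> s0 Xf; have [mf _] := Xf; have md := measurable_dilation s0 mf.
have H : (pow_int mu gam (tl (dilation s f)) <=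
    ((s `^ p%:num^-1 * F f) `^ q%:num)%:E)%E.
  apply: (@le_trans _ _ (pow_int mu gam (fun y => s * tl f y))).
    apply: le_pow_int => //; first exact: measurable_tail.
      by apply: measurable_funM => //; exact: measurable_tail.
    by move=> y; rewrite tail_ge0 tail_dilation.
  rewrite pow_int_scale_val ?(ltW s0)//; last first.
  - by move=> y; exact: tail_ge0.
  - exact: measurable_tail.
  rewrite pow_int_tail// powRM ?powR_ge0 ?Lorentz_fun_ge0// -powRrM.
  by rewrite [_^-1 * _]mulrC EFinM.
have XD : X (dilation s f) by apply/LorentzP => //; exact: le_lt_trans H (ltry _).
split=> //; move: H; rewrite pow_int_tail// lee_fin => H.
have := @ge0_ler_powR _ q%:num^-1 _ _ _ _ _ H.
rewrite !nnegrE !powR_ge0 invr_ge0// -!powRrM mulfV// !powRr1 ?Lorentz_fun_ge0//.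
  exact.
by rewrite mulr_ge0 ?powR_ge0 ?Lorentz_fun_ge0.
Qed.

(** The hypothesis is on the tail, so that the lemma serves both one indicator and a sum of
    indicators of disjoint sets. *)
Lemma Lorentz_step f s : measurable_fun I f -> 0 <= s ->
  (forall y, tl f y = if 0 <= y < 1 then s else 0) ->
  X f /\ F f = s `^ p%:num^-1.
Proof.
move=> mf s0 tE; have [|Xf ->] := @Lorentz_pow_int f (s `^ gam) mf.
  rewrite /pow_int; transitivity (\int[mu]_y ((s `^ gam)%:E * (\1_(`[0, 1[%classic) y)%:E))%E.
    apply: eq_integral => y _; rewrite tE indicE.
    case: (boolP (_ && _)) => y01; first by rewrite mem_set//= ?in_itv//= mule1.
    by rewrite memNset//= ?in_itv/= ?mule0 ?powR0//; exact/negP.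
  rewrite ge0_integralZl_EFin ?powR_ge0//; last first.
    exact/measurable_EFinP/measurable_indic.
  rewrite integral_indic// setIT.
  have mu01 : mu `[0, 1[%classic = 1%E.
    by rewrite lebesgue_measure_itv/= lte_fin ltr01 oppr0 adde0.
  by rewrite [X in (_ * X)%E]mu01 mule1.
by split=> //; rewrite -powRrM mulrAC mulfV// mul1r.
Qed.

Lemma tail_indic (A : set R) y : measurable A -> A `<=` I ->
  tl (\1_A) y = if 0 <= y < 1 then fine (mu A) else 0.
Proof.
move=> mA AI; rewrite /tail; case: ifP => //= y0; rewrite /distribution_fun.
have yE : y `^ q%:num^-1 < 1 = (y < 1).
  have powR_eq1 c : 1 `^ c = 1 :> R by rewrite powR1.
  apply/idP/idP => [H|H].
    have -> : y = (y `^ q%:num^-1) `^ q%:num by rewrite -powRrM mulVf// powRr1.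
    by rewrite -[ltRHS](powR_eq1 q%:num) gt0_ltr_powR ?nnegrE ?powR_ge0.
  by rewrite -[ltRHS](powR_eq1 q%:num^-1) gt0_ltr_powR ?nnegrE ?invr_gt0.
case: ifP => y1.
  congr (fine (mu _)); apply/seteqP; split=> t /=.
    rewrite indicE; case: (boolP (t \in A)); rewrite ?inE// => _ [_].
    by rewrite normr0 ltNge powR_ge0.
  by move=> At; split; [exact: AI|rewrite indicE mem_set// normr1 yE].
rewrite [X in mu X](_ : _ = set0) ?measure0//; apply/seteqP; split=> t //= [_].
rewrite indicE; case: (boolP (t \in A)) => _; rewrite ?normr0 ?normr1.
  by rewrite yE y1.
by rewrite ltNge powR_ge0.
Qed.

Lemma Lorentz_indic (A : set R) : measurable A -> A `<=` I ->
  X (\1_A) /\ F (\1_A) = fine (mu A) `^ p%:num^-1.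
Proof.
move=> mA AI; apply: Lorentz_step.
- by apply: measurable_funTS; exact: measurable_indic.
- by rewrite fine_ge0.
- by move=> y; rewrite tail_indic.
Qed.

Section DisjointSums.
Variables (n : nat) (x : 'I_n -> R -> R).
Hypothesis Xx : forall k, X (x k).
Hypothesis dx : forall j k, j != k -> disjoint_funs (x j) (x k).

Let mx k : measurable_fun I (x k). Proof. by case: (Xx k). Qed.

Let mtl k : measurable_fun setT (tl (x k)).
Proof. exact: measurable_tail. Qed.

Let tl0 k y : 0 <= tl (x k) y. Proof. exact: tail_ge0. Qed.

Let S := fun t => \sum_(k < n) x k t.

Let mS : measurable_fun I S. Proof. by apply: measurable_sum. Qed.

Let tlS : tl S = fun y => \sum_(k < n) tl (x k) y.
Proof. exact: tail_sum. Qed.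

(** The root of order q/p turns F^q into F^p: this is how the exponent [p] arises. *)
Let FpE f : X f ->
  (pow_int mu gam (tl f) `^ gam^-1)%E = (F f `^ p%:num)%:E.
Proof.
by move=> Xf; rewrite pow_int_tail// poweR_EFin -powRrM invf_div mulrC divfK.
Qed.

Lemma Lorentz_disjoint_sum : X S.
Proof.
apply/LorentzP => //; rewrite tlS; have [gam1|gam1] := leP gam 1.
  apply: le_lt_trans (pow_int_sum_le mu _ mtl tl0) _; first by rewrite gam_gt0.
  by under eq_bigr do rewrite pow_int_tail//; rewrite sumEFin ltry.
apply: (@lty_poweRy _ _ gam^-1); first by rewrite invr_neq0.
apply: le_lt_trans (pow_int_minkowski_sum mu (ltW gam1) mtl tl0) _.
by under eq_bigr do rewrite FpE//; rewrite sumEFin ltry.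
Qed.

Lemma Lorentz_fun_sum_le_q : q%:num <= p%:num ->
  F S `^ q%:num <= \sum_(k < n) F (x k) `^ q%:num.
Proof.
move=> qp; rewrite -lee_fin -pow_int_tail; last exact: Lorentz_disjoint_sum.
rewrite tlS; apply: le_trans (pow_int_sum_le mu _ mtl tl0) _.
  by rewrite gam_gt0 ler_pdivrMr// mul1r.
by rewrite -sumEFin; apply: lee_sum => k _; rewrite pow_int_tail.
Qed.

Lemma Lorentz_fun_sum_ge_p : q%:num <= p%:num ->
  \sum_(k < n) F (x k) `^ p%:num <= F S `^ p%:num.
Proof.
move=> qp; rewrite -lee_fin -FpE; last exact: Lorentz_disjoint_sum.
rewrite tlS; apply: le_trans (pow_int_reverse_minkowski_sum mu _ mtl tl0).
  by rewrite -sumEFin; apply: lee_sum => k _; rewrite FpE.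
by rewrite gam_gt0 ler_pdivrMr// mul1r.
Qed.

Lemma Lorentz_fun_sum_ge_q : p%:num <= q%:num ->
  \sum_(k < n) F (x k) `^ q%:num <= F S `^ q%:num.
Proof.
move=> pq; rewrite -lee_fin -pow_int_tail; last exact: Lorentz_disjoint_sum.
rewrite tlS; apply: le_trans (pow_int_sum_ge mu _ mtl tl0).
  by rewrite -sumEFin; apply: lee_sum => k _; rewrite pow_int_tail.
by rewrite ler_pdivlMr// mul1r.
Qed.

Lemma Lorentz_fun_sum_le_p : p%:num <= q%:num ->
  F S `^ p%:num <= \sum_(k < n) F (x k) `^ p%:num.
Proof.
move=> pq; rewrite -lee_fin -FpE; last exact: Lorentz_disjoint_sum.
rewrite tlS; apply: le_trans (pow_int_minkowski_sum mu _ mtl tl0) _.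
  by rewrite ler_pdivlMr// mul1r.
by rewrite -sumEFin; apply: lee_sum => k _; rewrite FpE.
Qed.

End DisjointSums.

End LorentzSpace.

(** * Subsequences of disjoint sequences *)

Lemma homo_ltn_neq (k : nat -> nat) i j :
  {homo k : m n / (m < n)%N} -> i != j -> k i != k j.
Proof.
move=> kinc; rewrite neq_ltn => /orP[/kinc|/kinc] lt; rewrite neq_ltn lt//.
by rewrite orbT.
Qed.

Section Subsequences.
Context {R : realType}.
Variables p q : {posnum R}.
Local Notation mu := (@lebesgue_measure R).
Local Notation I := (`[0%R, 1%R]%classic : set R).
Local Notation gam := (q%:num / p%:num).
Local Notation X := (Lorentz p q).
Local Notation tl := (tail q%:num).
Local Notation F := (Lorentz_fun p q).

Variable x : nat -> R -> R.
Hypothesis Xx : forall k, X (x k).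
Hypothesis dx : forall j k, j != k -> disjoint_funs (x j) (x k).
Hypothesis Fx_gt0 : forall k, 0 < F (x k).

Let mx k : measurable_fun I (x k). Proof. by case: (Xx k). Qed.

Lemma tail_at0_gt0 k : 0 < tl (x k) 0.
Proof.
rewrite lt_def tail_ge0 andbT; apply/eqP => t0.
have t00 : tl (x k) = fun=> 0.
  apply/funext => y; apply/eqP; rewrite eq_le tail_ge0 andbT -t0.
  exact: tail_le0.
have := pow_int_tail (Xx k); rewrite t00 pow_int0// => -[] /esym/eqP.
by rewrite gt_eqF// powR_gt0.
Qed.

(* The supports are disjoint subsets of [0, 1], so their measures tend to 0. *)
Lemma tail_at0_small e m : 0 < e -> exists2 k, (m < k)%N & tl (x k) 0 <= e.
Proof.
move=> e0; apply: contrapT => H.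
have {}H k : (m < k)%N -> e < tl (x k) 0.
  by move=> mk; rewrite ltNge; apply/negP => xe; apply: H; exists k.
pose n := (Num.trunc e^-1).+1.
have ne : e^-1 < n%:R by rewrite truncnS_gt.
pose z (i : 'I_n) := x (m.+1 + i).
have dz i j : i != j -> disjoint_funs (z i) (z j).
  by move=> ij; apply: dx; rewrite eqn_add2l.
have mz i : measurable_fun I (z i) by exact: mx.
have mS : measurable_fun I (fun t => \sum_(i < n) z i t) by exact: measurable_sum.
have := tail_le1 q%:num 0 mS; rewrite tail_sum// leNgt => /negP; apply.
apply: (@lt_le_trans _ _ (n%:R * e)).
  by rewrite -ltr_pdivrMr// div1r.
have -> : n%:R * e = \sum_(i < n) e by rewrite sumr_const card_ord mulr_natl.
by apply: ler_sum => i _; apply/ltW/H; rewrite ltnS leq_addr.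
Qed.

(** A level is fixed for every index first, and the next index is then chosen greedily by the size
    of its support. Hence the tolerance [eta] is indexed by the original sequence. *)
Lemma exists_separated_subseq (e : R) (eta : nat -> R) : 0 < e ->
  (forall k, 0 < eta k) ->
  exists al : nat -> R, exists k : nat -> nat,
  [/\ forall i, 0 <= al i <= tl (x i) 0,
      forall i, (pow_int mu gam (low_part (al i) (tl (x i))) <= (eta i)%:E)%E,
      {homo k : m n / (m < n)%N} &
      forall j, tl (x (k j.+1)) 0 <= e * al (k j)].
Proof.
move=> e0 eta0.
have /choice[al0 al0P] i : exists a, 0 < a /\
    (pow_int mu gam (low_part a (tl (x i))) <= (eta i)%:E)%E.
  have [|||||a a0 aP] := @pow_int_low_part_small _ _ R mu gam (tl (x i)) (eta i).
  - by [].
  - exact: measurable_tail.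
  - by move=> y; exact: tail_ge0.
  - by rewrite pow_int_tail// ltry.
  - exact: eta0.
  - by exists a.
(* The minimum keeps the level within the range of the tail; lowering a level only shrinks the low
   part. *)
pose al i := Num.min (al0 i) (tl (x i) 0).
have al_gt0 i : 0 < al i by rewrite lt_min tail_at0_gt0 (al0P i).1.
have /choice[next nextP] i : exists j, (i < j)%N /\ tl (x j) 0 <= e * al i.
  have [j ij jP] := @tail_at0_small (e * al i) i (mulr_gt0 e0 (al_gt0 i)).
  by exists j.
exists al, (fun j => iter j next 0%N); split.
- by move=> i; rewrite (ltW (al_gt0 i)) ge_min lexx orbT.
- move=> i; apply: le_trans (al0P i).2; apply: le_pow_int => //.
  + by apply: measurable_low_part; exact: measurable_tail.
  + by apply: measurable_low_part; exact: measurable_tail.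
  + move=> y; rewrite low_part_ge0/=; last by move=> ?; exact: tail_ge0.
    rewrite /low_part; case: ifP => [h|_]; last by case: ifP => // _; rewrite tail_ge0.
    by rewrite ifT// (le_trans h)// ge_min lexx.
- by apply: homo_ltn => [? ? ?|i]; [exact: ltn_trans|rewrite /= (nextP _).1].
- by move=> j; rewrite /= (nextP _).2.
Qed.

(** The bound is free of [a], so the subsequence is separated for all coefficients at once. *)
Lemma tailZ_le0 (f : R -> R) a y : measurable_fun I f -> tl (fun t => a * f t) y <= tl f 0.
Proof.
by move=> mf; rewrite tailZ0//; case: ifP => _; [exact: tail_ge0|exact: tail_le0].
Qed.

Lemma pow_int_high_partZ b (f : R -> R) (a : R) : X f ->
  (pow_int mu gam (high_part b (tl (fun t => a * f t)%R)) =
   (`|a| `^ q%:num)%:E * pow_int mu gam (high_part b (tl f)))%E.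
Proof.
move=> Xf; have [mf _] := Xf; rewrite tailZ0//; case: eqVneq => [->|a0].
  rewrite normr0 powR0// mul0e (_ : high_part _ _ = fun=> 0) ?pow_int0//.
  by apply/funext => y; rewrite /high_part if_same.
rewrite -pow_int_scale ?powR_gt0 ?normr_gt0//.
by apply: measurable_high_part; exact: measurable_tail.
Qed.

Lemma pow_int_low_partZ b (f : R -> R) (a : R) : X f ->
  (pow_int mu gam (low_part b (tl (fun t => a * f t)%R)) =
   (`|a| `^ q%:num)%:E * pow_int mu gam (low_part b (tl f)))%E.
Proof.
move=> Xf; have [mf _] := Xf; rewrite tailZ0//; case: eqVneq => [->|a0].
  rewrite normr0 powR0// mul0e (_ : low_part _ _ = fun=> 0) ?pow_int0//.
  by apply/funext => y; rewrite /low_part if_same.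
rewrite -pow_int_scale ?powR_gt0 ?normr_gt0//.
by apply: measurable_low_part; exact: measurable_tail.
Qed.

Section Combination.
Variables (k : nat -> nat) (a : nat -> R).
Hypothesis kinc : {homo k : m n / (m < n)%N}.

Lemma homo_ltn_geq_id j : (j <= k j)%N.
Proof. by elim: j => // j IH; apply: leq_ltn_trans IH _; exact: kinc. Qed.

Lemma Lorentz_term j : X (fun t => a j * x (k j) t).
Proof. exact: (LorentzZ _ (Xx _)).1. Qed.

Lemma disjoint_terms i j : i != j ->
  disjoint_funs (fun t => a i * x (k i) t) (fun t => a j * x (k j) t).
Proof.
move=> ij; have kij : k i != k j by exact: homo_ltn_neq.
have := dx kij; apply: filterS; first exact: (ae_filter_ringOfSetsType mu).
move=> t H It; have {}H := H It.
have [f0|f0] : x (k i) t = 0 \/ x (k j) t = 0.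
- by move: H; case: (leP `|x (k i) t| `|x (k j) t|) => _ /normr0_eq0; [left|right].
- by rewrite f0 mulr0 normr0 min_l.
- by rewrite f0 mulr0 normr0 min_r.
Qed.

Lemma Lorentz_combination n : X (fun t => \sum_(j < n) a j * x (k j) t).
Proof.
apply: (@Lorentz_disjoint_sum _ p q n (fun j t => a j * x (k j) t)).
- by move=> j; exact: Lorentz_term.
- by move=> i j ij; exact: disjoint_terms.
Qed.

Lemma tail_combination n : tl (fun t => \sum_(j < n) a j * x (k j) t) =
  fun y => \sum_(j < n) tl (fun t => a j * x (k j) t) y.
Proof.
apply: (@tail_sum _ q%:num n (fun j t => a j * x (k j) t)).
- by move=> j; have [] := Lorentz_term j.
- by move=> i j ij; exact: disjoint_terms.
Qed.

End Combination.

(** The low parts may take half of each integral; the other half and the factor 1/2 lost in summing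
    separated functions give the constant 1/4. *)
Lemma exists_subseq_ge m : 0 < m -> (forall i, m <= F (x i)) ->
  exists2 k : nat -> nat, {homo k : m n / (m < n)%N} &
  forall n (a : nat -> R),
    m `^ q%:num / 4 * \sum_(j < n) `|a j| `^ q%:num <=
    F (fun t => \sum_(j < n) a j * x (k j) t) `^ q%:num.
Proof.
move=> m0 mF.
have gam0 : 0 < gam by []; have q0 : 0 < q%:num by [].
pose J i := F (x i) `^ q%:num.
have J0 i : 0 < J i by rewrite powR_gt0.
(* This separation ratio becomes 1/2 after raising to the power q/p. *)
have eps0 : (0 : R) < 2^-1 `^ gam^-1 by rewrite powR_gt0 ?invr_gt0.
have [al [k [alP etaP kinc sep]]] := @exists_separated_subseq _ _ eps0
  (fun i => divr_gt0 (J0 i) (ltr0Sn _ 1)).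
exists k => // n a.
rewrite -lee_fin -pow_int_tail; last exact: Lorentz_combination.
rewrite tail_combination//.
have -> : m `^ q%:num / 4 = m `^ q%:num / 2 / 2 by field.
apply: (@pow_int_separated_ge _ _ R mu gam
  (fun j => tl (fun t => a j * x (k j) t)) (fun j => al (k j))
  (fun j => tl (x (k j)) 0) (fun j => `|a j| `^ q%:num)) => //.
- by move=> j; apply: measurable_tail => //; have [] := Lorentz_term k a j.
- by move=> j y; exact: tail_ge0.
- by move=> j y; exact: tailZ_le0.
- by move=> j; have /andP[] := alP (k j).
- by move=> j; have /andP[] := alP (k j).
- move=> j; have /andP[al0 _] := alP (k j).
  apply: (@le_trans _ _ ((2^-1 `^ gam^-1 * al (k j)) `^ gam)).
    by rewrite ge0_ler_powR ?nnegrE ?mulr_ge0 ?powR_ge0 ?tail_ge0 ?(ltW gam0).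
  by rewrite powRM ?powR_ge0// -powRrM mulVf ?gt_eqF// powRr1// mulrC.
- move=> j; rewrite pow_int_high_partZ//.
  have := @pow_int_low_high _ _ R mu (al (k j)) gam (tl (x (k j))) gam0
    (measurable_tail q0 (mx _)).
  rewrite pow_int_tail// => JE.
  have H : ((m `^ q%:num / 2)%:E <= pow_int mu gam (high_part (al (k j)) (tl (x (k j)))))%E.
    apply: (@le_trans _ _ (J (k j) / 2)%:E).
      by rewrite lee_fin ler_pM2r ?invr_gt0// ge0_ler_powR ?nnegrE ?(ltW m0)// (le_trans (ltW m0)).
    move: JE (etaP (k j)).
    have := pow_int_ge0 mu gam (low_part (al (k j)) (tl (x (k j)))).
    case: (pow_int mu gam (low_part _ _)) => [l| |] //.
    have := pow_int_ge0 mu gam (high_part (al (k j)) (tl (x (k j)))).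
    case: (pow_int mu gam (high_part _ _)) => [h| |] //.
    by move=> _ _ [JE]; rewrite !lee_fin /J JE => ?; lra.
  by rewrite mulrC EFinM lee_wpmul2l// lee_fin powR_ge0.
Qed.

Lemma exists_subseq_le M : p%:num <= q%:num -> (forall i, F (x i) <= M) ->
  exists2 k : nat -> nat, {homo k : m n / (m < n)%N} &
  forall n (a : nat -> R),
    F (fun t => \sum_(j < n) a j * x (k j) t) `^ q%:num <=
    2 `^ gam * (2 `^ gam + 1) * M `^ q%:num * \sum_(j < n) `|a j| `^ q%:num.
Proof.
move=> pq MF; have gam1 : 1 <= gam by rewrite ler_pdivlMr// mul1r.
have gam0 : 0 < gam by []; have q0 : 0 < q%:num by [].
have M0 : 0 < M by exact: lt_le_trans (Fx_gt0 0) (MF 0%N).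
(* The decay cancels the geometric weights of the low parts. It is indexed by i = k j, and j <= k j
   makes it at least as good as needed at place j. *)
pose eta i := (2 ^+ i.+1 : R) `^ (- gam) * M `^ q%:num.
have eta0 i : 0 < eta i by rewrite mulr_gt0// powR_gt0// exprn_gt0.
have half0 : (0 : R) < 2^-1 by rewrite invr_gt0.
have [al [k [alP etaP kinc sep]]] := @exists_separated_subseq _ _ half0 eta0.
exists k => // n a.
rewrite -lee_fin -pow_int_tail; last exact: Lorentz_combination.
rewrite tail_combination//.
(* The factor M^q is moved into the weights S_j = M^q |a_j|^q, leaving 1 as the constant for the
   full integrals. *)
rewrite -mulrA mulr_sumr -[X in _ * (X + 1)]mulr1.
apply: (@pow_int_separated_le _ _ R mu gam
  (fun j => tl (fun t => a j * x (k j) t)) (fun j => al (k j))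
  (fun j => tl (x (k j)) 0) (fun j => M `^ q%:num * `|a j| `^ q%:num)) => //.
- by move=> j; apply: measurable_tail => //; have [] := Lorentz_term k a j.
- by move=> j y; exact: tail_ge0.
- by move=> j y; exact: tailZ_le0.
- by move=> j; have /andP[] := alP (k j).
- by move=> j; have /andP[] := alP (k j).
- by move=> j; rewrite mulrC; exact: sep.
- move=> j; rewrite pow_int_low_partZ// mulrA [(_ * _ * _)%R]mulrC EFinM.
  rewrite lee_wpmul2l ?lee_fin ?powR_ge0//; apply: le_trans (etaP _) _.
  rewrite /eta lee_fin ler_wpM2r ?powR_ge0// !powRN.
  rewrite lef_pV2 ?posrE ?powR_gt0 ?exprn_gt0//.
  rewrite ge0_ler_powR ?nnegrE ?exprn_ge0// ler_eXn2l ?ltr1n//.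
  by rewrite ltnS homo_ltn_geq_id.
- move=> j; rewrite mul1r pow_int_tail; last exact: Lorentz_term.
  rewrite (LorentzZ _ (Xx _)).2 lee_fin powRM ?Lorentz_fun_ge0// mulrC.
  rewrite ler_wpM2r ?powR_ge0// ge0_ler_powR ?nnegrE ?Lorentz_fun_ge0//.
  exact: ltW.
Qed.

End Subsequences.

(** * Consequences of upper and lower estimates *)

Section Generalities.
Context {R : realType}.
Implicit Types (X : set (R -> R)) (N : (R -> R) -> R) (r : R).
Local Notation mu := (@lebesgue_measure R).
Local Notation I := (`[0%R, 1%R]%classic : set R).

Lemma ler_powR_root r (u v : R) : 0 < r -> 0 <= u -> u `^ r <= v -> u <= v `^ r^-1.
Proof.
move=> r0 u0 uv; have -> : u = (u `^ r) `^ r^-1.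
  by rewrite -powRrM mulfV ?gt_eqF// powRr1.
by rewrite ge0_ler_powR ?nnegrE ?powR_ge0 ?invr_ge0 ?(ltW r0)// (le_trans _ uv)// powR_ge0.
Qed.

Lemma powR_root_ler r (u v : R) : 0 < r -> 0 <= u -> 0 <= v -> v <= u `^ r -> v `^ r^-1 <= u.
Proof.
move=> r0 u0 v0 vu; have -> : u = (u `^ r) `^ r^-1.
  by rewrite -powRrM mulfV ?gt_eqF// powRr1.
by rewrite ge0_ler_powR ?nnegrE ?powR_ge0 ?invr_ge0 ?(ltW r0)//.
Qed.

Lemma powR_sumZ r n (c : R) (u : 'I_n -> R) : 0 < r -> 0 <= c -> (forall k, 0 <= u k) ->
  (\sum_(k < n) (c * u k) `^ r) `^ r^-1 = c * (\sum_(k < n) u k `^ r) `^ r^-1.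
Proof.
move=> r0 c0 u0; under eq_bigr do rewrite powRM//.
rewrite -mulr_sumr powRM ?powR_ge0 ?sumr_ge0//; last by move=> k _; exact: powR_ge0.
by rewrite -powRrM mulfV ?gt_eqF// powRr1.
Qed.

Lemma ler_powR_sum r n (u v : 'I_n -> R) : 0 < r -> (forall k, 0 <= u k <= v k) ->
  (\sum_(k < n) u k `^ r) `^ r^-1 <= (\sum_(k < n) v k `^ r) `^ r^-1.
Proof.
move=> r0 uv; have u0 k : 0 <= u k by have /andP[] := uv k.
have v0 k : 0 <= v k by have /andP[? ?] := uv k; exact: le_trans (u k) _ _ _ _.
rewrite ge0_ler_powR ?nnegrE ?invr_ge0 ?(ltW r0) ?sumr_ge0//;
  try by move=> k _; exact: powR_ge0.
apply: ler_sum => k _; have /andP[_ uvk] := uv k.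
by rewrite ge0_ler_powR ?nnegrE ?(ltW r0).
Qed.

(** Otherwise n^(a-b) would be bounded by C/c. This turns estimates for n-term sums into
    inequalities between exponents. *)
Lemma powR_growth_le (a b c C : R) : 0 < c ->
  (forall n, (0 < n)%N -> c * n%:R `^ a <= C * n%:R `^ b) -> a <= b.
Proof.
move=> c0 H; rewrite leNgt; apply/negP => ba.
have d0 : 0 < a - b by rewrite subr_gt0.
have C0 : 0 < C.
  by have := H 1%N isT; rewrite !powR1 !mulr1; exact: lt_le_trans.
pose n := (Num.trunc ((C / c) `^ (a - b)^-1)).+1.
have nn : (C / c) `^ (a - b)^-1 < n%:R by rewrite truncnS_gt.
have n0 : (0 : R) < n%:R by rewrite ltr0n.
have := H n isT; rewrite leNgt => /negP; apply.
have -> : a = (a - b) + b by rewrite subrK.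
rewrite powRD ?(gt_eqF n0) ?implybT// mulrA ltr_pM2r ?powR_gt0//.
rewrite -ltr_pdivrMl// mulrC.
have -> : C / c = ((C / c) `^ (a - b)^-1) `^ (a - b).
  by rewrite -powRrM mulVf ?gt_eqF// powRr1// divr_ge0 ?ltW.
by rewrite gt0_ltr_powR ?nnegrE ?powR_ge0 ?(ltW n0).
Qed.

(** The inner sum on the left is the coefficient family with a_j at place k_j and zeros
    elsewhere. *)
Lemma sum_reindex (V : lmodType R) n m (k : nat -> nat) (a : 'I_n -> R) (G : nat -> V) :
  (forall j : 'I_n, (k j < m)%N) ->
  \sum_(i < m) (\sum_(j < n) (k j == i)%:R * a j) *: G i =
  \sum_(j < n) a j *: G (k j).
Proof.
move=> km; under eq_bigr do rewrite scaler_suml.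
rewrite exchange_big/=; apply: eq_bigr => j _.
rewrite (bigD1 (Ordinal (km j)))//= eqxx mul1r big1 ?addr0// => i ij.
by rewrite (negbTE (_ : k j != i)) ?mul0r ?scale0r// eq_sym; exact: ij.
Qed.

(** A combination of n terms of the subsequence is one of the first k_n terms of the sequence,
    padded with zero coefficients; since r > 0 these add nothing to the sum of r-th powers. *)
Lemma upper_estimate_subseq N r C (x : nat -> R -> R) (k : nat -> nat) :
  0 < r -> {homo k : m n / (m < n)%N} ->
  upper_estimate N r C x -> upper_estimate N r C (x \o k).
Proof.
move=> r0 kinc U n a.
have kn (j : 'I_n) : (k j < k n)%N by apply: kinc.
have := U (k n) (fun i => \sum_(j < n) (k j == i)%:R * a j).
have -> : (fun t => \sum_(i < k n) (\sum_(j < n) (k j == i)%:R * a j) * x i t) =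
    (fun t => \sum_(j < n) a j * (x \o k) j t).
  by apply/funext => t; exact: (@sum_reindex R^o n (k n) k a (fun i => x i t)).
rewrite (_ : \sum_(i < k n) _ = \sum_(j < n) `|a j| `^ r)//.
rewrite -[RHS]mulr1 mulr_suml.
rewrite -(@sum_reindex R^o n (k n) k (fun j => `|a j| `^ r) (fun=> 1) kn).
apply: eq_bigr => i _; rewrite /GRing.scale/= mulr1.
have [[j kj]|nj] := pselect (exists j : 'I_n, k j = i).
  have kE (l : 'I_n) : l != j -> (k l == i) = false.
    by move=> lj; apply/negbTE; rewrite -kj; exact: homo_ltn_neq.
  have single (w : 'I_n -> R) : \sum_(l < n) (k l == i)%:R * w l = w j.
    rewrite (bigD1 j)//= kj eqxx mul1r big1 ?addr0// => l lj.
    by rewrite kE// mul0r.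
  by rewrite !single.
rewrite !big1 ?normr0 ?powR0 ?gt_eqF// => j _; rewrite (_ : (k j == i) = false) ?mul0r//;
  by apply/negP => /eqP kj; apply: nj; exists j.
Qed.

Lemma normalized_disjoint_subseq X N (x : nat -> R -> R) (k : nat -> nat) :
  {homo k : m n / (m < n)%N} -> normalized_disjoint X N x ->
  normalized_disjoint X N (x \o k).
Proof.
move=> kinc [Xx Nx dx]; split=> [j|j|i j ij] /=; [exact: Xx|exact: Nx|apply: dx].
by apply: homo_ltn_neq.
Qed.

(** A subsequence with the upper estimate has a further one with the lower estimate, and keeps the
    upper one. Unit coefficients give c n^(1/r') <= C n^(1/r) for all n. *)
Lemma UDS_UDT_le X N r r' : (exists x, normalized_disjoint X N x) ->
  0 < r -> 0 < r' -> UDS X N r -> UDT X N r' -> r <= r'.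
Proof.
move=> [x nx] r0 r'0 [C C0 /(_ _ nx)[k kinc U]] [c c0].
move=> /(_ _ (normalized_disjoint_subseq kinc nx))[l linc L].
have {}U := upper_estimate_subseq r0 linc U.
rewrite -lef_pV2 ?posrE//; apply: (@powR_growth_le _ _ c C c0) => n _.
have := le_trans (L n (fun=> 1)) (U n (fun=> 1)).
rewrite normr1; under eq_bigr do rewrite powR1.
by under [X in _ <= _ * (X `^ _)]eq_bigr do rewrite powR1; rewrite sumr_const card_ord.
Qed.

Lemma disjoint_indic (A B : set R) : A `&` B = set0 ->
  disjoint_funs (\1_A : R -> R) (\1_B : R -> R).
Proof.
move=> AB; apply: aeW => t _; rewrite !indicE.
have [tA|_] := boolP (t \in A); last by rewrite normr0 min_l.
have [tB|_] := boolP (t \in B); last by rewrite normr0 min_r.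
by move: tA tB; rewrite !inE => tA tB; have : (A `&` B) t by []; rewrite AB.
Qed.

(** [g] is ln s / b up to a bounded error, negligible against ln s. The inverse quotient is treated
    first, because its denominator is known to be large. A general filter covers both Boyd
    indices. *)
Lemma cvg_ln_ratio (G : set_system R) (FG : ProperFilter G) (b K : R) (g : R -> R) :
  b != 0 ->
  (forall M, \forall s \near G, M <= `|ln s|) ->
  (\forall s \near G, `|g s - ln s / b| <= K) ->
  (ln s / g s) @[s --> G] --> b.
Proof.
move=> b0 lnG gG.
have H : (g s / ln s) @[s --> G] --> b^-1.
  apply/cvgrPdist_le => /= e e0; near=> s.
  have l1 : `|g s - ln s / b| <= K by near: s.
  (* The summand 1 keeps ln s away from 0 when K = 0. *)
  have l2 : K / e + 1 <= `|ln s| by near: s; exact: lnG.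
  have K0 : 0 <= K by exact: le_trans (normr_ge0 _) l1.
  have ln0 : 0 < `|ln s|.
    by apply: lt_le_trans l2; rewrite ltr_wpDl// divr_ge0// ltW.
  rewrite distrC (_ : _ - _ = (g s - ln s / b) / ln s); last first.
    have lns : ln s != 0 by rewrite -normr_gt0.
    by field; rewrite lns b0.
  rewrite normrM normfV ler_pdivrMr//; apply: le_trans l1 _.
  rewrite -ler_pdivrMl// mulrC; lra.
have -> : (fun s => ln s / g s) = (fun s => (g s / ln s)^-1).
  by apply/funext => s; rewrite invf_div.
by have := cvgV (invr_neq0 b0) H; rewrite invrK; exact.
Unshelve. all: by end_near. Qed.

Lemma near_pinfty_ln (M : R) : \forall s \near +oo, M <= `|ln s|.
Proof.
near=> s; apply: le_trans (ler_norm _).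
have Ms : expR M <= s by near: s; exact: nbhs_pinfty_ge.
rewrite -(expRK M) ler_ln// posrE ?expR_gt0//.
Unshelve. all: by end_near. Qed.

Lemma near_right0_ln (M : R) : \forall s \near 0^'+, M <= `|ln s|.
Proof.
near=> s; have s0 : 0 < s by [].
have sM : s <= expR (- M) by near: s; apply: nbhs_right_le; exact: expR_gt0.
rewrite -normrN; apply: le_trans (ler_norm _); rewrite lerNr -(expRK (- M)).
by rewrite ler_ln// posrE expR_gt0.
Unshelve. all: by end_near. Qed.

End Generalities.

(** * Norms equivalent to the functional *)

Section LorentzNorm.
Context {R : realType}.
Variables p q : {posnum R}.
Local Notation mu := (@lebesgue_measure R).
Local Notation I := (`[0%R, 1%R]%classic : set R).
Local Notation X := (Lorentz p q).
Local Notation F := (Lorentz_fun p q).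
Variable N : (R -> R) -> R.
Variables c C : R.
Hypothesis c0 : 0 < c.
Hypothesis C0 : 0 < C.
Hypothesis cFN : forall f, X f -> c * F f <= N f.
Hypothesis NCF : forall f, X f -> N f <= C * F f.
Hypothesis NZ : forall a f, X f -> N (fun t => a * f t) = `|a| * N f.

Let N_ge0 f : X f -> 0 <= N f.
Proof. by move=> Xf; rewrite (le_trans _ (cFN Xf))// mulr_ge0 ?Lorentz_fun_ge0 ?ltW. Qed.

Let F_le f : X f -> F f <= c^-1 * N f.
Proof. by move=> Xf; rewrite ler_pdivlMl// (cFN Xf). Qed.

Let F_ge f : X f -> C^-1 * N f <= F f.
Proof. by move=> Xf; rewrite ler_pdivrMl// (NCF Xf). Qed.

Lemma lattice_upper_estimate_Lorentz r : 0 < r ->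
  (forall n (x : 'I_n -> R -> R), (forall k, X (x k)) ->
    (forall j k, j != k -> disjoint_funs (x j) (x k)) ->
    F (fun t => \sum_(k < n) x k t) `^ r <= \sum_(k < n) F (x k) `^ r) ->
  lattice_upper_estimate X N r.
Proof.
move=> r0 H; exists (C * c^-1); first by rewrite mulr_gt0 ?invr_gt0.
move=> n x Xx dx; have XS := Lorentz_disjoint_sum Xx dx.
apply: le_trans (NCF XS) _; rewrite -mulrA ler_wpM2l ?(ltW C0)//.
apply: le_trans (ler_powR_root r0 (Lorentz_fun_ge0 _ _ _) (H n x Xx dx)) _.
have N0 k : 0 <= N (x k) by exact: N_ge0 (Xx k).
have c'0 : 0 <= c^-1 by rewrite invr_ge0 ltW.
rewrite -(powR_sumZ r0 c'0 N0).
by apply: ler_powR_sum => // k; rewrite Lorentz_fun_ge0 (F_le (Xx k)).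
Qed.

Lemma lattice_lower_estimate_Lorentz r : 0 < r ->
  (forall n (x : 'I_n -> R -> R), (forall k, X (x k)) ->
    (forall j k, j != k -> disjoint_funs (x j) (x k)) ->
    \sum_(k < n) F (x k) `^ r <= F (fun t => \sum_(k < n) x k t) `^ r) ->
  lattice_lower_estimate X N r.
Proof.
move=> r0 H; exists (C * c^-1); first by rewrite mulr_gt0 ?invr_gt0.
move=> n x Xx dx; have XS := Lorentz_disjoint_sum Xx dx.
apply: (@le_trans _ _ (C * F (fun t => \sum_(k < n) x k t))); last first.
  by rewrite -mulrA ler_wpM2l ?(ltW C0)// (F_le XS).
apply: (@le_trans _ _ (C * (\sum_(k < n) F (x k) `^ r) `^ r^-1)); last first.
  rewrite ler_wpM2l ?(ltW C0)// powR_root_ler ?Lorentz_fun_ge0 ?H//.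
  by rewrite sumr_ge0// => k _; exact: powR_ge0.
rewrite -(powR_sumZ r0 (ltW C0) (fun k => Lorentz_fun_ge0 p q (x k))).
by apply: ler_powR_sum => // k; rewrite (N_ge0 (Xx k)) (NCF (Xx k)).
Qed.

Let combination_family x n (a : 'I_n -> R) : normalized_disjoint X N x ->
  [/\ forall k : 'I_n, X (fun t => a k * x k t),
      forall j k : 'I_n, j != k ->
        disjoint_funs (fun t => a j * x j t) (fun t => a k * x k t) &
      forall k : 'I_n, N (fun t => a k * x k t) = `|a k|].
Proof.
move=> [Xx Nx dx]; split.
- by move=> k; exact: (LorentzZ _ (Xx k)).1.
- move=> j k jk; pose b i := oapp a 0 (insub i).
  have bE (i : 'I_n) : b i = a i by rewrite /b valK.
  by rewrite -!bE; exact: (@disjoint_terms _ x dx id b).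
- by move=> k; rewrite (NZ _ (Xx k)) Nx mulr1.
Qed.

(** The whole sequence serves as the subsequence. Through [UDS_UDT_le] this also bounds lattice
    exponents by [q]. *)
Lemma UDS_lattice_upper r : lattice_upper_estimate X N r -> UDS X N r.
Proof.
move=> [K K0 H]; exists K => // x nx; exists id => // n a.
have [Xa da Na] := combination_family a nx.
have := H n (fun k t => a k * x k t) Xa da.
by under eq_bigr do rewrite Na.
Qed.

Lemma UDT_lattice_lower r : lattice_lower_estimate X N r -> UDT X N r.
Proof.
move=> [K K0 H]; exists K^-1; first by rewrite invr_gt0.
move=> x nx; exists id => // n a.
have [Xa da Na] := combination_family a nx.
have := H n (fun k t => a k * x k t) Xa da.
by under eq_bigr do rewrite Na; rewrite -ler_pdivrMl.
Qed.

Let F_gt0 x : normalized_disjoint X N x -> forall k, 0 < F (x k).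
Proof.
move=> [Xx Nx _] k; apply: lt_le_trans (F_ge (Xx k)).
by rewrite Nx mulr1 invr_gt0.
Qed.

(** The subsequence lemmas take coefficients indexed by all naturals, the estimates to be proved
    take finite families. *)
Let extend n (a : 'I_n -> R) (j : nat) : R := oapp a 0 (insub j).

Let extendE n (a : 'I_n -> R) (j : 'I_n) : extend a j = a j.
Proof. by rewrite /extend valK. Qed.

Let extend_combination n (a : 'I_n -> R) (x : nat -> R -> R) (k : nat -> nat) :
  (fun t => \sum_(j < n) extend a j * x (k j) t) =
  (fun t => \sum_(j < n) a j * (x \o k) j t).
Proof. by apply/funext => t; apply: eq_bigr => j _; rewrite extendE. Qed.

Let extend_powR n (a : 'I_n -> R) r :
  \sum_(j < n) `|extend a j| `^ r = \sum_(j < n) `|a j| `^ r.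
Proof. by apply: eq_bigr => j _; rewrite extendE. Qed.

Let q0 : 0 < q%:num. Proof. by []. Qed.

(** For q <= p the lattice upper q-estimate suffices. For q > p a separated subsequence is
    extracted, normalization giving the upper bound 1/c for [F]. *)
Lemma UDS_q : UDS X N q%:num.
Proof.
have [qp|pq] := leP q%:num p%:num.
  apply/UDS_lattice_upper/lattice_upper_estimate_Lorentz => // n x Xx dx.
  exact: Lorentz_fun_sum_le_q.
pose g : R := q%:num / p%:num.
pose K : R := 2 `^ g * (2 `^ g + 1) * c^-1 `^ q%:num.
have K0 : 0 < K.
  by rewrite !mulr_gt0 ?powR_gt0 ?addr_gt0 ?powR_gt0 ?invr_gt0.
exists (C * K `^ q%:num^-1); first by rewrite mulr_gt0// powR_gt0.
move=> x nx; have [Xx Nx dx] := nx.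
have Fc i : F (x i) <= c^-1 by rewrite (le_trans (F_le (Xx i)))// Nx mulr1.
have [k kinc H] := exists_subseq_le Xx dx (F_gt0 nx) (ltW pq) Fc.
exists k => // n a; have := H n (extend a).
rewrite (extend_combination a x k) extend_powR => {}H.
have XS : X (fun t => \sum_(j < n) a j * (x \o k) j t).
  have := Lorentz_combination Xx dx (extend a) kinc n.
  by rewrite (extend_combination a x k).
apply: le_trans (NCF XS) _; rewrite -mulrA ler_wpM2l ?(ltW C0)//.
rewrite -powRM ?(ltW K0)//; last by rewrite sumr_ge0// => j _; exact: powR_ge0.
by apply: ler_powR_root => //; exact: Lorentz_fun_ge0.
Qed.

(** The lower bound for separated sums holds for every value of q/p, so one argument covers both
    cases; normalization gives the lower bound 1/C for [F]. *)
Lemma UDT_q : UDT X N q%:num.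
Proof.
pose K : R := C^-1 `^ q%:num / 4.
have K0 : 0 < K by rewrite divr_gt0// powR_gt0 ?invr_gt0.
exists (c * K `^ q%:num^-1); first by rewrite mulr_gt0// powR_gt0.
move=> x nx; have [Xx Nx dx] := nx.
have Fc i : C^-1 <= F (x i) by rewrite (le_trans _ (F_ge (Xx i)))// Nx mulr1.
have C'0 : 0 < C^-1 by rewrite invr_gt0.
have [k kinc H] := exists_subseq_ge Xx dx (F_gt0 nx) C'0 Fc.
exists k => // n a; have := H n (extend a).
rewrite (extend_combination a x k) extend_powR => {}H.
have XS : X (fun t => \sum_(j < n) a j * (x \o k) j t).
  have := Lorentz_combination Xx dx (extend a) kinc n.
  by rewrite (extend_combination a x k).
apply: le_trans (cFN XS); rewrite -mulrA ler_wpM2l ?(ltW c0)//.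
rewrite -powRM ?(ltW K0)//; last by rewrite sumr_ge0// => j _; exact: powR_ge0.
apply: powR_root_ler => //; first exact: Lorentz_fun_ge0.
rewrite mulr_ge0 ?(ltW K0)// sumr_ge0// => j _; exact: powR_ge0.
Qed.

(** Normalized indicators of dyadic intervals. They keep UDS and UDT from holding vacuously. *)
Lemma exists_normalized_disjoint : exists x, normalized_disjoint X N x.
Proof.
pose A k : set R := `]2 ^- k.+1, 2 ^- k]%classic.
have A_lt k : (2 ^- k.+1 : R) < 2 ^- k.
  by rewrite exprS invfM gtr_pMl ?invr_gt0 ?exprn_gt0// invf_lt1// ltr1n.
have A_le m n : (m <= n)%N -> (2 ^- n : R) <= 2 ^- m.
  by move=> mn; rewrite lef_pV2 ?posrE ?exprn_gt0// ler_eXn2l ?ltr1n.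
have AI k : A k `<=` I.
  move=> t; rewrite /A/= !in_itv/= => /andP[lt le].
  rewrite (ltW (lt_trans _ lt)) ?invr_gt0 ?exprn_gt0//=.
  by rewrite (le_trans le)// (le_trans (A_le 0%N _ _))// expr0 invr1.
have [XA FA] : (forall k, X (\1_(A k))) /\ forall k, 0 < F (\1_(A k)).
  split=> k; first by apply: (Lorentz_indic p q _ _).1 => //; exact: measurable_itv.
  rewrite (Lorentz_indic p q _ _).2//; last exact: measurable_itv.
  rewrite powR_gt0// /A lebesgue_measure_itv/= lte_fin A_lt -EFinB/=.
  by rewrite subr_gt0.
have NA k : 0 < N (\1_(A k)) by rewrite (lt_le_trans _ (cFN (XA k)))// mulr_gt0.
exists (fun k t => (N (\1_(A k)))^-1 * \1_(A k) t); split.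
- by move=> k; exact: (LorentzZ _ (XA k)).1.
- by move=> k; rewrite (NZ _ (XA k)) gtr0_norm ?invr_gt0// mulVf ?gt_eqF.
move=> j k jk; apply: (@disjoint_terms _ (fun k => \1_(A k)) _ id (fun k => (N (\1_(A k)))^-1)) => //.
move=> {jk} {}j {}k jk; apply: disjoint_indic.
wlog jk' : j k jk / (j < k)%N.
  move=> H; have := jk; rewrite neq_ltn => /orP[lt|lt]; first exact: H.
  by rewrite setIC; apply: H; rewrite // eq_sym.
apply/seteqP; split=> t //= []; rewrite /A/= !in_itv/= => /andP[jt _] /andP[_ tk].
have := le_lt_trans (le_trans tk (A_le _ _ jk')) jt.
by rewrite ltxx.
Qed.

(** Indicators of n consecutive intervals of length 1/n. Their tails add up to that of the indicator
    of [0, 1]; the family tests the exponent [p]. *)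
Lemma step_family n : (0 < n)%N -> exists x : 'I_n -> R -> R,
  [/\ forall k, X (x k), forall j k, j != k -> disjoint_funs (x j) (x k),
      forall k, F (x k) = n%:R `^ (- p%:num^-1),
      X (fun t => \sum_(k < n) x k t) & F (fun t => \sum_(k < n) x k t) = 1].
Proof.
move=> n0; have nR0 : (0 : R) < n%:R by rewrite ltr0n.
pose A (k : 'I_n) : set R := `]k%:R / n%:R, k.+1%:R / n%:R]%classic.
have mA k : measurable (A k) by exact: measurable_itv.
have AI k : A k `<=` I.
  move=> t; rewrite /A/= !in_itv/= => /andP[lt le].
  rewrite (ltW (le_lt_trans _ lt)) ?divr_ge0 ?(ltW nR0)//=.
  by rewrite (le_trans le)// ler_pdivrMr// mul1r ler_nat.
have muA k : fine (mu (A k)) = n%:R^-1.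
  rewrite /A lebesgue_measure_itv/= lte_fin ltr_pM2r ?invr_gt0// ltr_nat ltnSn.
  by rewrite -EFinB/= -mulrBl -natrB// subSnn mul1r.
have dA j k : j != k -> disjoint_funs (\1_(A j) : R -> R) (\1_(A k)).
  move=> jk; apply: disjoint_indic.
  wlog jk' : j k jk / (j < k)%N.
    move=> H; have := jk; rewrite -val_eqE neq_ltn => /orP[lt|lt]; first exact: H.
    by rewrite setIC; apply: H; rewrite // eq_sym.
  apply/seteqP; split=> t //= []; rewrite /A/= !in_itv/= => /andP[_ tj] /andP[kt _].
  have := lt_le_trans kt tj; rewrite ltr_pM2r ?invr_gt0// ltr_nat ltnS.
  by rewrite leqNgt jk'.
have XA k : X (\1_(A k)) by exact: (Lorentz_indic p q _ _).1.
have [XS FS] : X (fun t => \sum_(k < n) \1_(A k) t) /\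
    F (fun t => \sum_(k < n) \1_(A k) t) = 1 `^ p%:num^-1.
  have mI k : measurable_fun I (\1_(A k) : R -> R).
    by apply: measurable_funTS; exact: measurable_indic.
  apply: Lorentz_step => //.
  - exact: measurable_sum.
  - move=> y; rewrite tail_sum//.
    under eq_bigr do rewrite tail_indic// muA.
    case: ifP => _; last by rewrite big1.
    by rewrite sumr_const card_ord -[LHS]mulr_natl mulfV ?gt_eqF.
exists (fun k => \1_(A k)); split=> //.
- by move=> k; rewrite (Lorentz_indic p q _ _).2// muA -powR_inv1 ?(ltW nR0)// -powRrM mulN1r.
- by rewrite FS powR1.
Qed.

(** On the step family the estimate says that n^(1/r - 1/p) is bounded below by a positive constant,
    uniformly in n. *)
Lemma lattice_upper_le_p r : 0 < r -> lattice_upper_estimate X N r -> r <= p%:num.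
Proof.
move=> r0 [K K0 H]; rewrite -lef_pV2 ?posrE// -subr_ge0.
apply: (@powR_growth_le _ _ _ c (K * C) c0) => n n0.
have [x [Xx dx Fx XS FS]] := step_family n0.
have nR0 : (0 : R) < n%:R by rewrite ltr0n.
rewrite powRr0 -[X in _ * X <= _]FS; apply: le_trans (cFN XS) _.
apply: le_trans (H n x Xx dx) _; rewrite -mulrA ler_wpM2l ?(ltW K0)//.
apply: (@le_trans _ _ (C * (\sum_(k < n) F (x k) `^ r) `^ r^-1)).
  rewrite -(powR_sumZ r0 (ltW C0) (fun k => Lorentz_fun_ge0 p q (x k))).
  by apply: ler_powR_sum => // k; rewrite (N_ge0 (Xx k)) (NCF (Xx k)).
rewrite ler_wpM2l ?(ltW C0)//; under eq_bigr do rewrite Fx.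
rewrite sumr_const card_ord -[X in X `^ _]mulr_natl powRM ?powR_ge0 ?ler0n//.
rewrite -!powRrM ?mulrA mulfK ?gt_eqF// -powRD// (gt_eqF nR0) implybT//.
Qed.

Lemma lattice_lower_ge_p r : 0 < r -> lattice_lower_estimate X N r -> p%:num <= r.
Proof.
move=> r0 [K K0 H]; rewrite -lef_pV2 ?posrE// -subr_le0.
apply: (@powR_growth_le _ _ _ c (K * C) c0) => n n0.
have [x [Xx dx Fx XS FS]] := step_family n0.
have nR0 : (0 : R) < n%:R by rewrite ltr0n.
rewrite powRr0 mulr1 -[X in _ <= X]mulr1 -mulrA -[X in _ * (_ * X)]FS.
apply: (@le_trans _ _ (K * N (fun t => \sum_(k < n) x k t))); last first.
  by rewrite ler_wpM2l ?(ltW K0)// (NCF XS).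
apply: le_trans (H n x Xx dx).
apply: (@le_trans _ _ (c * (\sum_(k < n) F (x k) `^ r) `^ r^-1)); last first.
  rewrite -(powR_sumZ r0 (ltW c0) (fun k => Lorentz_fun_ge0 p q (x k))).
  apply: ler_powR_sum => // k; rewrite (cFN (Xx k)) mulr_ge0 ?(ltW c0)//.
  exact: Lorentz_fun_ge0.
rewrite ler_wpM2l ?(ltW c0)//; under eq_bigr do rewrite Fx.
rewrite sumr_const card_ord.
rewrite -[X in _ <= X `^ _]mulr_natl powRM ?powR_ge0 ?ler0n//.
by rewrite -!powRrM ?mulrA mulfK ?gt_eqF// -powRD ?(gt_eqF nR0) ?implybT.
Qed.

(** * Norms of dilations and Boyd indices *)

Lemma opnorm_dilation_le s f : 0 < s -> X f -> N f <= 1 ->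
  N (dilation s f) <= C * c^-1 * s `^ p%:num^-1.
Proof.
move=> s0 Xf Nf; have [XD FD] := Lorentz_dilation s0 Xf.
apply: le_trans (NCF XD) _; rewrite -mulrA ler_wpM2l ?(ltW C0)//.
apply: le_trans FD _; rewrite mulrC ler_wpM2r ?powR_ge0//.
by apply: le_trans (F_le Xf) _; rewrite ler_piMr ?invr_ge0 ?(ltW c0).
Qed.

Lemma opnorm_dilation_ge s : 0 < s -> exists2 f, X f /\ N f <= 1 &
  c * C^-1 * s `^ p%:num^-1 <= N (dilation s f).
Proof.
(* The largest m for which [0, m] and its dilation [0, m s] both lie in [0, 1], so that nothing is
   cut off and [F] is multiplied by exactly s^(1/p). The factor [a] makes [F] equal to 1/C. *)
move=> s0; pose m := Num.min 1 s^-1; pose a := C^-1 * m `^ (- p%:num^-1).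
have m0 : 0 < m by rewrite lt_min ltr01 invr_gt0.
have m1 : m <= 1 by rewrite ge_min lexx.
have ms0 : 0 <= m * s by rewrite mulr_ge0 ?ltW.
have ms : m * s = Num.min 1 s.
  by rewrite /m minr_pMl ?(ltW s0)// mul1r mulVf ?gt_eqF// minC.
have a0 : 0 < a by rewrite mulr_gt0 ?invr_gt0 ?powR_gt0.
have iF (b : R) : 0 <= b <= 1 -> X (\1_(`[0, b]%classic) : R -> R) /\
    F (\1_(`[0, b]%classic)) = b `^ p%:num^-1.
  move=> /andP[b0 b1].
  have bI : `[0, b]%classic `<=` I.
    by apply: subset_itv; rewrite ?bnd_simp.
  have [] := Lorentz_indic p q (measurable_itv `[0, b]) bI => XB ->; split=> //.
  rewrite lebesgue_measure_itv/= lte_fin; case: ltP => //= [_|b0']; first by rewrite subr0.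
  by have -> : b = 0 by apply/eqP; rewrite eq_le b0' b0.
have m01 : 0 <= m <= 1 by rewrite (ltW m0).
have ms01 : 0 <= m * s <= 1 by rewrite ms0 ms ge_min lexx.
have [Xm Fm] := iF m m01.
have [Xf Ff] := LorentzZ a Xm.
exists (fun t => a * \1_(`[0, m]%classic) t).
  split=> //; apply: le_trans (NCF Xf) _; rewrite Ff Fm gtr0_norm// /a.
  rewrite -mulrA -powRD ?addNr ?powRr0 ?(gt_eqF m0) ?implybT//.
  by rewrite mulr1 mulfV ?gt_eqF.
have [Xs Fs] := iF (m * s) ms01.
have [XD FD] := LorentzZ a Xs.
have -> : dilation s (fun t => a * \1_(`[0, m]%classic) t) =
    (fun t => a * \1_(`[0, m * s]%classic) t).
  apply/funext => t; rewrite /dilation -mulrA; congr (_ * _).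
  rewrite !indicE -natrM mulnb; congr (nat_of_bool _)%:R.
  rewrite -ms; apply/andP/idP; rewrite !inE/= !in_itv/=; last first.
    move=> /andP[t0 tm]; rewrite t0 tm divr_ge0 ?(ltW s0)//=.
    by rewrite ler_pdivrMr.
  by case.
apply: le_trans (cFN XD); rewrite FD Fs gtr0_norm// -mulrA ler_wpM2l ?(ltW c0)//.
rewrite /a powRM ?(ltW m0) ?(ltW s0)// -mulrA [X in _ <= _ * X]mulrA.
by rewrite -powRD ?addNr ?powRr0 ?mul1r ?(gt_eqF m0) ?implybT.
Qed.

Lemma opnorm_dilation_ln s : 0 < s ->
  `|ln (opnorm X N (dilation s)) - ln s / p%:num| <= `|ln (C * c^-1)|.
Proof.
move=> s0; have sp0 : 0 < s `^ p%:num^-1 by rewrite powR_gt0.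
have K0 : 0 < C * c^-1 by rewrite mulr_gt0 ?invr_gt0.
have [f [Xf Nf] lb] := opnorm_dilation_ge s0.
set o := opnorm _ _ _.
(* The real supremum is meaningful only for a nonempty bounded set, so boundedness is recorded
   before it is used. *)
have ub : ubound [set N (dilation s f) | f in [set f | X f /\ N f <= 1]]
    (C * c^-1 * s `^ p%:num^-1).
  by move=> _ [g [Xg Ng] <-]; exact: opnorm_dilation_le.
have o_le : o <= C * c^-1 * s `^ p%:num^-1.
  by apply: ge_sup => //; exists (N (dilation s f)), f.
have o_ge : (C * c^-1)^-1 * s `^ p%:num^-1 <= o.
  rewrite invfM invrK mulrC [_ * c]mulrC mulrC; apply: le_trans lb _.
  by apply: ub_le_sup; [exists (C * c^-1 * s `^ p%:num^-1)|exists f].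
have o0 : 0 < o by apply: lt_le_trans o_ge; rewrite mulr_gt0// invr_gt0.
have lns : ln (s `^ p%:num^-1) = ln s / p%:num by rewrite ln_powR mulrC.
have ole : ln o <= ln (C * c^-1) + ln s / p%:num.
  by rewrite -lns -lnM ?posrE// ler_ln ?posrE// mulr_gt0.
have oge : - ln (C * c^-1) + ln s / p%:num <= ln o.
  by rewrite -lns -lnV ?posrE// -lnM ?posrE ?invr_gt0// ler_ln ?posrE// mulr_gt0 ?invr_gt0.
have := ler_norm (ln (C * c^-1)); have := ler_norm (- ln (C * c^-1)).
by rewrite normrN ler_norml; lra.
Qed.

Lemma Boyd_p : is_Boyd_p X N p%:num.
Proof.
apply: cvg_ln_ratio; first by rewrite gt_eqF.
  exact: near_pinfty_ln.
near=> s; apply: opnorm_dilation_ln; near: s; exact: nbhs_pinfty_gt.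
Unshelve. all: by end_near. Qed.

Lemma Boyd_q : is_Boyd_q X N p%:num.
Proof.
apply: cvg_ln_ratio; first by rewrite gt_eqF.
  exact: near_right0_ln.
by near=> s; apply: opnorm_dilation_ln.
Unshelve. all: by end_near. Qed.

(** The step family bounds every exponent by [p] and UDT_q bounds it by [q]; the supremum is
    attained, by subadditivity or Minkowski. *)
Lemma up_index_Lorentz : 1 < p%:num -> 1 < q%:num ->
  up_index X N = (Num.min p%:num q%:num)%:E.
Proof.
move=> p1 q1; apply/eqP; rewrite eq_le; apply/andP; split.
  apply: ge_ereal_sup => _ [r [r1 Hr] <-]; rewrite lee_fin le_min.
  have r0 : 0 < r by exact: lt_trans r1.
  rewrite lattice_upper_le_p//=.
  exact: UDS_UDT_le exists_normalized_disjoint r0 q0 (UDS_lattice_upper Hr) UDT_q.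
apply: ereal_sup_ubound; exists (Num.min p%:num q%:num) => //.
split; first by rewrite lt_min p1 q1.
have [pq|qp] := leP p%:num q%:num;
  apply: lattice_upper_estimate_Lorentz => // n x Xx dx.
  exact: Lorentz_fun_sum_le_p.
by apply: Lorentz_fun_sum_le_q => //; exact: ltW.
Qed.

Lemma low_index_Lorentz : 1 < p%:num -> 1 < q%:num ->
  low_index X N = (Num.max p%:num q%:num)%:E.
Proof.
move=> p1 q1; apply/eqP; rewrite eq_le; apply/andP; split; last first.
  apply: le_ereal_inf_tmp => _ [r [r1 Hr] <-]; rewrite lee_fin ge_max.
  have r0 : 0 < r by exact: lt_trans r1.
  rewrite lattice_lower_ge_p//=.
  exact: UDS_UDT_le exists_normalized_disjoint q0 r0 UDS_q (UDT_lattice_lower Hr).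
apply: ereal_inf_lbound; exists (Num.max p%:num q%:num) => //.
split; first by rewrite lt_max p1.
have [pq|qp] := leP p%:num q%:num;
  apply: lattice_lower_estimate_Lorentz => // n x Xx dx.
  exact: Lorentz_fun_sum_ge_q.
by apply: Lorentz_fun_sum_ge_p => //; exact: ltW.
Qed.

Lemma ell_d_Lorentz : 1 < q%:num -> ell_d X N = q%:num%:E.
Proof.
move=> q1; apply/eqP; rewrite eq_le; apply/andP; split.
  apply: ge_ereal_sup => _ [r [r1 Hr] <-]; rewrite lee_fin.
  exact: UDS_UDT_le exists_normalized_disjoint (lt_trans ltr01 r1) q0 Hr UDT_q.
by apply: ereal_sup_ubound; exists q%:num => //; split=> //; exact: UDS_q.
Qed.

Lemma u_d_Lorentz : 1 < q%:num -> u_d X N = q%:num%:E.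
Proof.
move=> q1; apply/eqP; rewrite eq_le; apply/andP; split; last first.
  apply: le_ereal_inf_tmp => _ [r [r1 Hr] <-]; rewrite lee_fin.
  exact: UDS_UDT_le exists_normalized_disjoint q0 (lt_trans ltr01 r1) UDS_q Hr.
by apply: ereal_inf_lbound; exists q%:num => //; split=> //; exact: UDT_q.
Qed.

End LorentzNorm.

(** Merges the two cases of [Lorentz_norm]: for q <= p, [N] is the functional itself and both
    constants are 1. *)
Lemma Lorentz_norm_equivalent (R : realType) (p q : {posnum R}) N :
  Lorentz_norm p q N -> exists c C : R, [/\ 0 < c, 0 < C,
    forall f, Lorentz p q f -> c * Lorentz_fun p q f <= N f,
    forall f, Lorentz p q f -> N f <= C * Lorentz_fun p q f &
    forall a f, Lorentz p q f -> N (fun t => a * f t) = `|a| * N f].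
Proof.
rewrite /Lorentz_norm; case: ifP => _ => [H|[[_ _ NZ _ _ _] [c [C [c0 C0 H]]]]].
  have NE f : Lorentz p q f -> N f = Lorentz_fun p q f.
    by move=> Xf; rewrite /Lorentz_fun -H.
  exists 1, 1; split=> [||f Xf|f Xf|a f Xf].
  - exact: ltr01.
  - exact: ltr01.
  - by rewrite mul1r (NE f Xf).
  - by rewrite mul1r (NE f Xf).
  - by rewrite (NE f Xf) (NE _ (LorentzZ a Xf).1) (LorentzZ a Xf).2.
exists c, C; split=> [||f Xf|f Xf|].
- exact: c0.
- exact: C0.
- by have [+ _] := H f Xf; rewrite -(EFin_Lorentz_fun Xf) -EFinM lee_fin.
- by have [_] := H f Xf; rewrite -(EFin_Lorentz_fun Xf) -EFinM lee_fin.
- exact: NZ.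
Qed.

Theorem proposition5 (R : realType) (p q : {posnum R})
    (hp : 1 < p%:num) (hq : 1 < q%:num)
    (N : (R -> R) -> R) (hN : Lorentz_norm p q N) :
  [/\ is_Boyd_p (Lorentz p q) N p%:num /\ is_Boyd_q (Lorentz p q) N p%:num,
      up_index (Lorentz p q) N = (Num.min p%:num q%:num)%:E /\
      low_index (Lorentz p q) N = (Num.max p%:num q%:num)%:E &
      [/\ UDS (Lorentz p q) N q%:num, UDT (Lorentz p q) N q%:num,
          ell_d (Lorentz p q) N = q%:num%:E & u_d (Lorentz p q) N = q%:num%:E]].
Proof.
have [c [C [c0 C0 cFN NCF NZ]]] := Lorentz_norm_equivalent hN.
split; [split|split|split].
- exact: (Boyd_p c0 C0 cFN NCF).
- exact: (Boyd_q c0 C0 cFN NCF).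
- exact: (up_index_Lorentz c0 C0 cFN NCF NZ).
- exact: (low_index_Lorentz c0 C0 cFN NCF NZ).
- exact: (UDS_q c0 C0 cFN NCF NZ).
- exact: (UDT_q c0 C0 cFN NCF).
- exact: (ell_d_Lorentz c0 C0 cFN NCF NZ).
- exact: (u_d_Lorentz c0 C0 cFN NCF NZ).
Qed.
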